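(* Fix integers $N\ge3$ and $r,s\ge1$ and parameters $p_0,p_1,p_2,p_3\in[0,1]$. Assume that $P^\circ:=(P_{A'}^\circ)^r(P_B^\circ)^s$, as well as all cyclic permutations of the product $(P_{A'}^\circ)^r(P_B^\circ)^s$, are ergodic. Let $\{X_n^\circ\}_{n\ge0}$ be a nonhomogeneous Markov chain in $\Sigma^\circ$ whose successive one-step transition matrices are $P_{A'}^\circ$ ($r$ times), $P_B^\circ$ ($s$ times), $P_{A'}^\circ$ ($r$ times), $P_B^\circ$ ($s$ times), and so on, with arbitrary distribution of $X_0^\circ$. Let $\xi_n:=w^\circ(X_{n-1}^\circ,X_n^\circ)$ and $S_n:=\xi_1+\cdots+\xi_n$ for $n\ge1$. Then $$\frac{S_n}{n}\to\mu^\circ_{[r,s]'}\quad\text{a.s.},$$ and, if $(\sigma^\circ_{[r,s]'})^2>0$, then $$\frac{S_n-n\mu^\circ_{[r,s]'}}{\sqrt{n(\sigma^\circ_{[r,s]'})^2}}\to_d N(0,1)\quad\text{as }n\to\infty.$$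
   Context: Players are labeled $1,\dots,N$ in a circle (labels mod $N$). For $\eta\in\{0,1\}^N$ let $m_x(\eta):=2\eta(x-1)+\eta(x+1)$, let $\eta_x$ be $\eta$ with the $x$th coordinate flipped, and let $q_m:=1-p_m$. For $y\in\{x-1,x+1\}$, $\eta^{x,y,1}$ (resp. $\eta^{x,y,-1}$) is $\eta$ with $\eta(x)$ set to $1$ and $\eta(y)$ set to $0$ (resp. $\eta(x)$ set to $0$ and $\eta(y)$ set to $1$). The state space is $\Sigma^\circ:=\{0,1\}^N\times\{-1,0,1\}$ (statuses of the players, and total profit from the last game). $P_B^\circ$: $P_B^\circ((\eta,s),(\eta_x,1))=N^{-1}p_{m_x(\eta)}$ if $\eta(x)=0$ and $0$ if $\eta(x)=1$; $P_B^\circ((\eta,s),(\eta_x,-1))=N^{-1}q_{m_x(\eta)}$ if $\eta(x)=1$ and $0$ if $\eta(x)=0$; $P_B^\circ((\eta,s),(\eta,1))=N^{-1}\sum_{x:\eta(x)=1}p_{m_x(\eta)}$; $P_B^\circ((\eta,s),(\eta,-1))=N^{-1}\sum_{x:\eta(x)=0}q_{m_x(\eta)}$; all other entries $0$. $P_{A'}^\circ$: $P_{A'}^\circ((\eta,s),(\zeta,0))=\frac1{4N}\#\{(x,y,\epsilon):1\le x\le N,\ y\in\{x-1,x+1\},\ \epsilon\in\{-1,1\},\ \eta^{x,y,\epsilon}=\zeta\}$; all other entries $0$. Payoff: $w^\circ((\eta,s),(\eta_x,t))=t$ if $\eta(x)=(1-t)/2$, and $w^\circ((\eta,s),(\eta,t))=t$,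 for $t\in\{-1,1\}$; $w^\circ=0$ otherwise. $\dot P_B^\circ$ is the entrywise product of $P_B^\circ$ with the matrix of $w^\circ$. ''Ergodic'' means having a unique stationary distribution to which the chain converges from every initial distribution (transient/inaccessible states are allowed). Let the row vector $\pi^\circ$ be the unique stationary distribution of $P^\circ$, $\mathbf 1$ the column vector of ones indexed by $\Sigma^\circ$, and $Z^\circ:=(I-(P^\circ-\mathbf 1\pi^\circ))^{-1}$. Define $$\mu^\circ_{[r,s]'}:=\frac1{r+s}\sum_{v=0}^{s-1}\pi^\circ(P_{A'}^\circ)^r(P_B^\circ)^v\dot P_B^\circ\mathbf 1,$$ $$(\sigma^\circ_{[r,s]'})^2:=\frac1{r+s}\Big\{s-\sum_{v=0}^{s-1}\big(\pi^\circ(P_{A'}^\circ)^r(P_B^\circ)^v\dot P_B^\circ\mathbf 1\big)^2+2\Big[\sum_{0\le u<v\le s-1}\pi^\circ(P_{A'}^\circ)^r(P_B^\circ)^u\dot P_B^\circ\big((P_B^\circ)^{v-u-1}-\mathbf 1\pi^\circ(P_{A'}^\circ)^r(P_B^\circ)^v\big)\dot P_B^\circ\mathbf 1$$ $$\qquad+\sum_{u=0}^{s-1}\sum_{v=0}^{s-1}\pi^\circ(P_{A'}^\circ)^r(P_B^\circ)^u\dot P_B^\circ(P_B^\circ)^{s-u-1}(Z^\circ-\mathbf 1\pi^\circ)(P_{A'}^\circ)^r(P_B^\circ)^v\dot P_B^\circ\mathbf 1\Big]\Big\}.$$ *)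

(* Defs.v *)
From HB Require Import structures.
From mathcomp Require Import all_boot all_order all_algebra.
From mathcomp Require Import all_classical all_reals all_analysis.

Set Implicit Arguments.
Unset Strict Implicit.
Unset Printing Implicit Defensive.

Import Order.TTheory GRing.Theory Num.Theory.
Import numFieldNormedType.Exports.

Local Open Scope classical_set_scope.
Local Open Scope ring_scope.

Section FiniteChains.
Variable R : realType.

Definition kernel_mx (S : finType) (K : S -> S -> R) : 'M[R]_#|S| :=
  \matrix_(i, j) K (enum_val i) (enum_val j).

Definition is_distr n (v : 'rV[R]_n) : Prop :=
  (forall i, 0 <= v 0 i) /\ \sum_i v 0 i = 1.

Definition stationary n (Q : 'M[R]_n) (v : 'rV[R]_n) : Prop :=
  is_distr v /\ v *m Q = v.

(* Irreducibility is not required: transient and inaccessible states are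
   allowed. *)
Definition ergodic n (Q : 'M[R]_n) : Prop :=
  exists v : 'rV[R]_n,
    [/\ stationary Q v,
        forall v' : 'rV[R]_n, stationary Q v' -> v' = v &
        forall v0 : 'rV[R]_n, is_distr v0 ->
          forall i, (fun k : nat => (v0 *m Q ^+ k) 0 i) @ \oo --> v 0 i].

(* The step from time n to time n + 1 has transition kernel Q n, the Markov
   property being multiplied out so as not to condition on null events.  The
   distribution of X 0 is unconstrained. *)
Definition markov_chain (d : measure_display) (Omega : measurableType d)
    (P : probability Omega R) (S : finType) (Q : nat -> S -> S -> R)
    (X : nat -> Omega -> S) : Prop :=
  (forall n x, measurable [set w | X n w = x]) /\
  (forall n (x : nat -> S),
     P [set w | forall k, (k <= n.+1)%N -> X k w = x k] =
     (P [set w | forall k, (k <= n)%N -> X k w = x k] *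
      (Q n (x n) (x n.+1))%:E)%E).

(* Pointwise convergence of the distribution functions at the continuity
   points of the limiting one. *)
Definition cvg_in_distribution (d : measure_display) (Omega : measurableType d)
    (P : probability Omega R) (Y : nat -> Omega -> R)
    (nu : probability (measurableTypeR R) R) : Prop :=
  forall x : R,
    {for x, continuous (fun y : R => fine (nu [set` `]-oo, y]]))} ->
    (fun n => P [set w | Y n w <= x]) @ \oo --> nu [set` `]-oo, x]].

End FiniteChains.

Section Games.
Variables (R : realType) (N : nat).

(* The players 1, ..., N are the elements of 'I_N; ord_pred x and ordS x are
   x - 1 and x + 1 mod N. *)
Definition config : finType := {ffun 'I_N -> bool}.

Definition profits : seq int := [:: -1; 0; 1].

(* The set {-1, 0, 1} as a subtype of int. *)
Definition profit : finType := seq_sub profits.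

Definition state : finType := (config * profit)%type.

Definition flip (eta : config) (x : 'I_N) : config :=
  [ffun z => if z == x then ~~ eta z else eta z].

(* eta^{x,y,1} for b = true and eta^{x,y,-1} for b = false. *)
Definition transfer (eta : config) (x y : 'I_N) (b : bool) : config :=
  [ffun z => if z == x then b else if z == y then ~~ b else eta z].

(* The value of inord is exact, as 2 * eta (x-1) + eta (x+1) <= 3. *)
Definition nbhd (eta : config) (x : 'I_N) : 'I_4 :=
  inord (2 * eta (ord_pred x) + eta (ordS x))%N.

(* The configurations eta and flip eta x, for x in 'I_N, are pairwise distinct:
   the first sum has at most one term, and none if zeta = eta. *)
Definition kernelB (p : 'I_4 -> R) (a b : state) : R :=
  let: (eta, _) := a in
  let: (zeta, t) := b in
  let pm x := p (nbhd eta x) in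
  let qm x := 1 - p (nbhd eta x) in
  (\sum_(x < N | zeta == flip eta x)
     (if ssval t == 1 then (if ~~ eta x then N%:R^-1 * pm x else 0)
      else if ssval t == -1 then (if eta x then N%:R^-1 * qm x else 0)
      else 0))
  + (if zeta == eta then
       if ssval t == 1 then N%:R^-1 * \sum_(x < N | eta x) pm x
       else if ssval t == -1 then N%:R^-1 * \sum_(x < N | ~~ eta x) qm x
       else 0
     else 0).

Definition kernelA' (a b : state) : R :=
  let: (eta, _) := a in
  let: (zeta, t) := b in
  if ssval t == 0 then
    #|[pred u : 'I_N * 'I_N * bool |
        let: (x, y, e) := u in
        (y \in [:: ord_pred x; ordS x]) && (transfer eta x y e == zeta)]|%:R
    / (4 * N)%:R
  else 0.

Definition payoff (a b : state) : R :=
  let: (eta, _) := a in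
  let: (zeta, t) := b in
  let tR : R := (ssval t)%:~R in
  if (ssval t \in ([:: -1; 1] : seq int)) &&
     ((zeta == eta) ||
      [exists x, (zeta == flip eta x) && ((eta x)%:R == (1 - tR) / 2)])
  then tR else 0.

Variable p : 'I_4 -> R.

Definition mxB : 'M[R]_#|state| := kernel_mx (kernelB p).

Definition mxA' : 'M[R]_#|state| := kernel_mx kernelA'.

Definition dotB : 'M[R]_#|state| :=
  kernel_mx (fun a b => kernelB p a b * payoff a b).

Variables r s : nat.

Definition period_mx : 'M[R]_#|state| := mxA' ^+ r *m mxB ^+ s.

(* The cyclic permutation of A'^r B^s starting at its k-th factor. *)
Definition cyclic_mx (k : nat) : 'M[R]_#|state| :=
  \prod_(M <- rot k (nseq r mxA' ++ nseq s mxB)) M.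

(* The kernel of the step from time n to time n + 1. *)
Definition step_kernel (n : nat) : state -> state -> R :=
  if (n %% (r + s) < r)%N then kernelA' else kernelB p.

Variable pi0 : 'rV[R]_#|state|.

Local Notation one := (const_mx 1 : 'cV[R]_#|state|).

Definition Zmx : 'M[R]_#|state| :=
  invmx (1%:M - (period_mx - one *m pi0)).

Definition mean_profit : R :=
  (r + s)%:R^-1 *
  \sum_(v < s) (pi0 *m mxA' ^+ r *m mxB ^+ v *m dotB *m one) 0 0.

Definition variance_profit : R :=
  (r + s)%:R^-1 *
  (s%:R
   - \sum_(v < s) ((pi0 *m mxA' ^+ r *m mxB ^+ v *m dotB *m one) 0 0) ^+ 2
   + 2 *
     (\sum_(v < s) \sum_(u < v)
        (pi0 *m mxA' ^+ r *m mxB ^+ u *m dotB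
         *m (mxB ^+ (v - u - 1) - one *m pi0 *m mxA' ^+ r *m mxB ^+ v)
         *m dotB *m one) 0 0
      + \sum_(u < s) \sum_(v < s)
        (pi0 *m mxA' ^+ r *m mxB ^+ u *m dotB *m mxB ^+ (s - u - 1)
         *m (Zmx - one *m pi0) *m mxA' ^+ r *m mxB ^+ v
         *m dotB *m one) 0 0)).

(* S_n = xi_1 + ... + xi_n with xi_(k+1) = w (X_k, X_(k+1)). *)
Definition cumulative_profit (Omega : Type) (X : nat -> Omega -> state)
    (n : nat) (w : Omega) : R :=
  \sum_(k < n) payoff (X k w) (X k.+1 w).

End Games.

(* Main.v *)
Require Import Defs.
From HB Require Import structures.
From mathcomp Require Import all_boot all_order all_algebra.
From mathcomp Require Import all_classical all_reals all_analysis.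
From mathcomp Require Import ring lra zify.
Import Order.TTheory GRing.Theory Num.Theory.
Import numFieldNormedType.Exports.
Local Open Scope classical_set_scope.
Local Open Scope ring_scope.

(* Solving the Poisson equation over one period with the fundamental matrix
   gives correctors g and q, periodic in time, which turn the centred sum x into
   x^2/2 + g x + q, a quantity with constant drift v/2 per step, where v is the
   asymptotic variance.  So E (S_n - n mu)^2 = O(n), and Borel-Cantelli along
   n = k^4 yields the strong law, as increments are bounded.

   For the central limit theorem, U(t, x) = Phi ((a - x) / sqrt (eps + t)) solves
   the heat equation.  The same correctors make
   U(v (n-k), x) + g U_x(v (n-k), x) + q U_xx(v (n-k), x) a martingale up to an
   error O(n^(-3/2)) per step when eps is of order n, so that
   E Phi ((a - S_n + n mu) / sqrt eps) is close to Phi (a / sqrt (eps + v n)).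
   Letting eps / n tend to 0 squeezes the distribution functions; no
   characteristic function is involved. *)

Set Implicit Arguments.
Unset Strict Implicit.
Unset Printing Implicit Defensive.

(** A Poisson equation over one period is solvable when its right-hand side has stationary mean
    zero. For [g] this fixes the centring, hence [mu]; for [q] it fixes the drift [v / 2], and
    checking that mean against the given formula is what identifies the limiting variance. Both
    equations hold state by state, so every estimate is uniform in the starting state and covers an
    arbitrary law of [X 0].

    The correctors in the central limit theorem answer an obstacle: in a Taylor expansion of one
    step, the first and second order terms have conditional means that depend on the state and on
    the phase. Attached to [U_x] and [U_xx], [g] and [q] absorb these fluctuations.

    The exponent 4 is the least [m] such that, at times [n = k^m] with threshold [k^(m-1)],
    Chebyshev's bound of order [k^m / k^(2m-2)] is summable. The threshold has the order of the gap
    between consecutive times and is negligible against [n]. *)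

Section PointwiseDerivatives.
Context {R : realType}.
Implicit Types (f g : R -> R) (x c : R).

(** Differentiation rules with explicit lambdas: they chain along the shape of a formula, and
    [is_derive_eq] then leaves an algebraic identity. *)
Lemma is_derive1_add f g x df dg : is_derive x 1 f df -> is_derive x 1 g dg ->
  is_derive x 1 (fun y => f y + g y) (df + dg).
Proof. exact: is_deriveD. Qed.

Lemma is_derive1_sub f g x df dg : is_derive x 1 f df -> is_derive x 1 g dg ->
  is_derive x 1 (fun y => f y - g y) (df - dg).
Proof. exact: is_deriveB. Qed.

Lemma is_derive1_mul f g x df dg : is_derive x 1 f df -> is_derive x 1 g dg ->
  is_derive x 1 (fun y => f y * g y) (f x * dg + g x * df).
Proof. exact: is_deriveM. Qed.

Lemma is_derive1_mull c f x df : is_derive x 1 f df ->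
  is_derive x 1 (fun y => c * f y) (c * df).
Proof. exact: is_deriveZ. Qed.

Lemma is_derive1_exp f n x df : is_derive x 1 f df ->
  is_derive x 1 (fun y => f y ^+ n) (n%:R * f x ^+ n.-1 * df).
Proof.
move=> h; rewrite (_ : (fun _ => _) = f ^+ n); first exact: is_deriveX.
by apply/funext => y; rewrite fctE.
Qed.

Lemma is_derive1_cst c x : is_derive x 1 (fun=> c) 0.
Proof. exact: is_derive_cst. Qed.

Lemma is_derive1_id x : is_derive x 1 (fun y : R => y) 1.
Proof. exact: is_derive_id. Qed.

Lemma is_derive1_opp f x df : is_derive x 1 f df ->
  is_derive x 1 (fun y => - f y) (- df).
Proof. exact: is_deriveN. Qed.

End PointwiseDerivatives.

(** * The normal distribution function and its derivatives *)

Section NormalDistributionFunction.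
Context {R : realType}.
Implicit Types x y z a : R.

Definition Phi x : R := fine (normal_prob (0 : R) 1 `]-oo, x]).

Lemma Phi_nondecreasing : {homo Phi : x y / x <= y}.
Proof.
move=> x y xy; apply: fine_le; rewrite ?fin_num_measure//.
by apply: le_measure; rewrite ?inE//; apply: subset_itvl; rewrite bnd_simp.
Qed.

Lemma Phi_ge0 x : 0 <= Phi x.
Proof. exact: fine_ge0. Qed.

Lemma Phi_le1 x : Phi x <= 1.
Proof.
by rewrite -lee_fin fineK ?fin_num_measure// probability_le1.
Qed.

Lemma normal_pdf01 x :
  normal_pdf 0 1 x = normal_peak 1 * expR (- x ^+ 2 / 2) :> R.
Proof.
by rewrite normal_pdfE ?oner_eq0// /normal_fun subr0 expr1n.
Qed.

Lemma is_derive_Phi x : is_derive x 1 Phi (normal_pdf 0 1 x).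
Proof.
have xu : x < x + 1 by rewrite ltrDl.
have mi : (lebesgue_measure).-integrable `]-oo, x + 1] (EFin \o normal_pdf (0 : R) 1).
  by apply: (integrableS _ _ (subsetT _)) => //; exact: integrable_normal_pdf.
have c : {for x, continuous (normal_pdf (0 : R) 1)}.
  by apply: continuous_normal_pdf; rewrite oner_eq0.
have [d e] := continuous_FTC1 xu mi (ltNyr _) c.
by split; [exact: d | rewrite -derive1E; exact: e].
Qed.

Lemma is_derive_normal_pdf x :
  is_derive x 1 (normal_pdf 0 1) (- x * normal_pdf 0 1 x).
Proof.
rewrite (_ : normal_pdf 0 1 = fun y : R => normal_peak 1 * expR (- y ^+ 2 / 2)); last first.
  by apply/funext => y; exact: normal_pdf01.
have h : is_derive x 1 (fun y : R => - y ^+ 2 / 2) (- x).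
  rewrite (_ : (fun _ => _) = fun y : R => (- 2^-1) * (y ^+ 2)); last first.
    by apply/funext => y; field.
  apply: (is_derive_eq (is_derive1_mull _ (is_derive1_exp 2 (is_derive1_id x)))).
  by rewrite /=; field.
apply: (is_derive_eq (is_derive1_mull _ (is_derive1_comp _ h))).
by rewrite /GRing.scale/=; field.
Qed.

(* [DPhi k] is the k-th derivative of [Phi]; the recurrence is that of the Hermite
   polynomials. *)
Fixpoint DPhi k z : R :=
  match k with
  | 0%N => Phi z
  | k1.+1 => match k1 with
    | 0%N => normal_pdf 0 1 z
    | k2.+1 => - z * DPhi k1 z - k2%:R * DPhi k2 z
    end
  end.

Lemma DPhiSS k z : DPhi k.+2 z = - z * DPhi k.+1 z - k%:R * DPhi k z.
Proof. by []. Qed.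

(** Differentiating the recurrence of rank [k] gives that of rank [k.+1]. At rank 0 the coefficient
    of [Phi] vanishes, leaving the equation of the density. *)
Lemma is_derive_DPhi k z : is_derive z 1 (DPhi k) (DPhi k.+1 z).
Proof.
(* The recurrence has order two, so the induction carries two consecutive ranks. *)
suff: is_derive z 1 (DPhi k) (DPhi k.+1 z) /\
      is_derive z 1 (DPhi k.+1) (DPhi k.+2 z) by case.
elim: k => [|k [h1 h2]].
  split; first exact: is_derive_Phi.
  by rewrite DPhiSS mul0r subr0; exact: is_derive_normal_pdf.
split=> //.
rewrite (_ : DPhi k.+2 = fun y => - y * DPhi k.+1 y - k%:R * DPhi k y)//.
apply: (is_derive_eq (is_derive1_sub (is_derive1_mul
  (is_derive1_opp (is_derive1_id z)) h2) (is_derive1_mull _ h1))).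
rewrite [in RHS]DPhiSS; ring.
Qed.

(** For [1 <= k <= 4], [DPhi k] is the density times a polynomial of degree at most 3. Order 4 is
    the highest to occur: a second derivative in time is a fourth one in space. *)
Lemma DPhi_bounded : exists B : R, 0 < B /\ forall k z, (k <= 4)%N -> `|DPhi k z| <= B.
Proof.
pose p : R := normal_peak 1.
have p0 : 0 < p by apply: normal_peak_gt0; rewrite oner_eq0.
have f0 z : 0 <= normal_pdf 0 1 z :> R by exact: normal_pdf_ge0.
have f1 z : normal_pdf 0 1 z <= p :> R by apply: normal_pdf_ub; rewrite oner_eq0.
(* [z^4 / 16] is the square of [z^2 / 4], hence at most the square of [expR (z^2 / 4)], which
   cancels the exponential of the density. *)
have f4 z : z ^+ 4 * normal_pdf 0 1 z <= 16 * p.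
  rewrite normal_pdf01 -/p mulrCA (mulrC 16) ler_pM2l//.
  have -> : - z ^+ 2 / 2 = - (z ^+ 2 / 4 + z ^+ 2 / 4) by field.
  rewrite expRN -ler_pdivlMr ?invr_gt0 ?expR_gt0// invrK expRD.
  have h := expR_ge1Dx (z ^+ 2 / 4); have h0 := sqr_ge0 z.
  have -> : z ^+ 4 = 16 * (z ^+ 2 / 4 * (z ^+ 2 / 4)) by field.
  by rewrite ler_pM2l//; apply: ler_pM => //; lra.
(* [68 = 4 (1 + 16)]; the added 1 covers [Phi] itself. *)
have f z c : `|c| <= 4 * (1 + z ^+ 4) -> `|c * normal_pdf 0 1 z| <= 1 + 68 * p.
  move=> hc; rewrite normrM (ger0_norm (f0 z)).
  apply: (@le_trans _ _ (4 * (1 + z ^+ 4) * normal_pdf 0 1 z)).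
    exact: ler_wpM2r.
  have := f1 z; have := f4 z; lra.
exists (1 + 68 * p); split; first lra.
move=> k z.
(* Squares from which [lra] bounds each polynomial factor by [4 (1 + z^4)]. *)
have q1 := sqr_ge0 (z ^+ 2 - 1).
have q2 := sqr_ge0 (z - 1).
have q3 := sqr_ge0 (z + 1).
have q4 := sqr_ge0 (z ^+ 2 - z).
have q5 := sqr_ge0 (z ^+ 2 + z).
case: k => [_|[_|[_|[_|[_|//]]]]].
- by rewrite /= ger0_norm ?Phi_ge0//; have := Phi_le1 z; lra.
- by rewrite /= ger0_norm//; have := f1 z; lra.
- rewrite DPhiSS/= mul0r subr0.
  apply: f; rewrite ler_norml; apply/andP; split; lra.
- rewrite !DPhiSS/= (_ : _ - _ = (z ^+ 2 - 1) * normal_pdf 0 1 z); last ring.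
  apply: f; rewrite ler_norml; apply/andP; split; lra.
- rewrite !DPhiSS/= (_ : _ - _ = (3 * z - z ^+ 3) * normal_pdf 0 1 z); last ring.
  apply: f; rewrite ler_norml; apply/andP; split; lra.
Qed.

(** [Phi] is the distribution function of the identity seen as a random variable, which gives its
    limits at infinity. *)
Let idTR : measurableTypeR R -> R := idfun.

#[local] HB.instance Definition _ :=
  @isMeasurableFun.Build _ _ _ _ idTR (@measurable_id _ _ setT).

Lemma Phi_small eta : 0 < eta -> exists z, Phi z <= eta.
Proof.
move=> e0.
have := @cvg_cdfNy0 _ _ _ (normal_prob (0:R) 1) (idTR : {RV _ >-> R}).
move=> /fine_cvgP[_] /cvgrPdist_le /(_ _ e0) h.
near (-oo%R : set_system R) => z.
exists z; apply: le_trans (_ : `|0 - Phi z| <= _); first by rewrite sub0r normrN ler_norm.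
by near: z.
Unshelve. all: by end_near. Qed.

Lemma Phi_large eta : 0 < eta -> exists z, 1 - eta <= Phi z.
Proof.
move=> e0.
have := @cvg_cdfy1 _ _ _ (normal_prob (0:R) 1) (idTR : {RV _ >-> R}).
move=> /fine_cvgP[_] /cvgrPdist_le /(_ _ e0) h.
near (+oo%R : set_system R) => z.
exists z; have : `|1 - Phi z| <= eta by near: z.
by move/(le_trans (ler_norm _)); lra.
Unshelve. all: by end_near. Qed.

End NormalDistributionFunction.

(** * The heat equation and bounds on its solution *)

(* [heat eps a 0 t x] is [Phi ((a - x) / sqrt (eps + t))], and [heat eps a k] is
   its k-th derivative in x: the negative sign of [isd] absorbs the signs. *)
Section HeatEquation.
Context {R : realType}.
Variables (eps a : R).
Hypothesis eps_gt0 : 0 < eps.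

Definition isd t : R := - (Num.sqrt (eps + t))^-1.

Definition heat k t x : R := isd t ^+ k * DPhi k ((x - a) * isd t).

Lemma is_derive_heat_space k (t x : R) :
  is_derive x 1 (heat k t) (heat k.+1 t x).
Proof.
have h : is_derive x 1 (fun y => (y - a) * isd t) (isd t).
  apply: (is_derive_eq (is_derive1_mul (is_derive1_sub (is_derive1_id x)
    (is_derive1_cst a x)) (is_derive1_cst (isd t) x))); ring.
apply: (is_derive_eq (is_derive1_mull (isd t ^+ k) (is_derive1_comp
  (is_derive_DPhi k _) h))).
by rewrite /heat exprS; ring.
Qed.

Lemma is_derive_isd (t : R) : 0 <= t -> is_derive t 1 isd (- isd t ^+ 3 / 2).
Proof.
move=> t0.
have st : 0 < eps + t by rewrite ltr_wpDr.
have sq : Num.sqrt (eps + t) != 0 by rewrite gt_eqF// sqrtr_gt0.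
have h : is_derive t 1 (fun y => Num.sqrt (eps + y)) (2 * Num.sqrt (eps + t))^-1.
  apply: (is_derive_eq (is_derive1_comp (is_derive1_sqrt st)
   (is_derive1_add (is_derive1_cst eps t) (is_derive1_id t)))).
  by rewrite add0r mulr1.
have h2 := is_derive1_opp
  (@is_deriveV _ (fun y => Num.sqrt (eps + y)) _ _ _ sq h).
apply: (is_derive_eq h2).
by rewrite /isd /GRing.scale/=; field.
Qed.

(** Since [isd' = - isd^3 / 2], the derivative is [isd^(k+2) / 2] times [- k DPhi k - z DPhi k.+1],
    at [z = (x - a) isd]: this is the Hermite recurrence. *)
Lemma is_derive_heat_time k (t x : R) : 0 <= t ->
  is_derive t 1 (fun u => heat k u x) (heat k.+2 t x / 2).
Proof.
move=> t0.
have h := is_derive_isd t0.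
have h2 := is_derive1_mull (x - a) h.
apply: (is_derive_eq (is_derive1_mul (is_derive1_exp k h)
  (is_derive1_comp (is_derive_DPhi k _) h2))).
rewrite /heat DPhiSS.
case: k => [|k]; rewrite [X in X * (_%:R * _ * _)]/comp.
  by field.
by rewrite [k.+1.-1]/= !exprS; field.
Qed.

(** The role of [eps]: derivatives stay bounded down to [t = 0], where without smoothing the
    solution becomes an indicator. *)
Lemma heat_le (B t : R) k x : 0 <= t -> (forall z, `|DPhi k z| <= B) ->
  `|heat k t x| <= B * (Num.sqrt eps)^-1 ^+ k.
Proof.
move=> t0 hB; rewrite /heat normrM mulrC ler_pM//.
rewrite normrX lerXn2r ?nnegrE ?invr_ge0 ?sqrtr_ge0//.
rewrite /isd normrN ger0_norm ?invr_ge0 ?sqrtr_ge0//.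
have st : 0 < eps + t by rewrite ltr_wpDr.
by rewrite lef_pV2 ?posrE ?sqrtr_gt0// ler_wsqrtr// lerDl.
Qed.

End HeatEquation.

(** * Taylor remainders, with unoptimised constants *)

Section TaylorBounds.
Context {R : realType}.
Implicit Types (f df : R -> R) (x D B : R).

(** Hypotheses are confined to the segment from [x] to [x + D] because time derivatives of [heat]
    are established at nonnegative times only. Parametrising by [u] avoids cases on the sign of
    [D]. *)
Lemma mvt_le f df x D B :
  (forall u : R, 0 <= u <= 1 -> is_derive (x + u * D) 1 f (df (x + u * D))) ->
  (forall u : R, 0 <= u <= 1 -> `|df (x + u * D)| <= B) ->
  `|f (x + D) - f x| <= B * `|D|.
Proof.
move=> hd hB.
pose g u := f (x + u * D).
have gd (u : R) : 0 <= u <= 1 -> is_derive u 1 g (df (x + u * D) * D).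
  move=> hu; have h : is_derive u 1 (fun y : R => x + y * D) D.
    apply: (is_derive_eq (is_derive1_add (is_derive1_cst x u)
      (is_derive1_mul (is_derive1_id u) (is_derive1_cst D u)))); ring.
  exact: (@is_derive1_comp _ f (fun y => x + y * D) u _ _ (hd u hu) h).
have [||c c01] := @MVT_segment R g (fun u => df (x + u * D) * D) 0 1 ler01.
- by move=> u; rewrite in_itv/= => /andP[u0 u1]; apply: gd; rewrite !ltW.
- apply: derivable_within_continuous => u; rewrite in_itv/= => hu.
  by have [] := gd u hu.
rewrite /g mul1r mul0r addr0 subr0 mulr1 => ->.
by rewrite normrM ler_wpM2r//; apply: hB; move: c01; rewrite in_itv.
Qed.

Lemma taylor1_le f (f1 f2 : R -> R) x D B :
  (forall u : R, 0 <= u <= 1 -> is_derive (x + u * D) 1 f (f1 (x + u * D))) ->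
  (forall u : R, 0 <= u <= 1 -> is_derive (x + u * D) 1 f1 (f2 (x + u * D))) ->
  (forall u : R, 0 <= u <= 1 -> `|f2 (x + u * D)| <= B) ->
  `|f (x + D) - f x - D * f1 x| <= B * `|D| ^+ 2.
Proof.
move=> hd hd1 hB.
have B0 : 0 <= B by apply: le_trans (hB 0 _); rewrite // lexx ler01.
(* Removing the tangent leaves the derivative [f1 y - f1 x], which is at most [B |D|] on the
   segment. *)
pose g y := f y - f1 x * y.
have -> : f (x + D) - f x - D * f1 x = g (x + D) - g x by rewrite /g; ring.
have := @mvt_le g (fun y => f1 y - f1 x) x D (B * `|D|).
rewrite -mulrA -expr2; apply => u hu.
  apply: (is_derive_eq (is_derive1_sub (hd u hu)
    (is_derive1_mull (f1 x) (is_derive1_id _)))); ring.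
have /andP[u0 u1] := hu.
have : `|f1 (x + u * D) - f1 x| <= B * `|u * D|.
  apply: (@mvt_le _ f2) => v /andP[v0 v1]; rewrite mulrA; [apply: hd1|apply: hB].
  - by rewrite mulr_ge0// mulr_ile1.
  - by rewrite mulr_ge0// mulr_ile1.
move/le_trans; apply; rewrite ler_wpM2l// normrM ger0_norm//.
by rewrite ler_piMl.
Qed.

Lemma taylor2_le f (f1 f2 f3 : R -> R) x D B :
  (forall y : R, is_derive y 1 f (f1 y)) -> (forall y : R, is_derive y 1 f1 (f2 y)) ->
  (forall y : R, is_derive y 1 f2 (f3 y)) -> (forall y, `|f3 y| <= B) ->
  `|f (x + D) - f x - D * f1 x - D ^+ 2 / 2 * f2 x| <= B * `|D| ^+ 3.
Proof.
move=> hd hd1 hd2 hB.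
have B0 : 0 <= B by apply: le_trans (hB x).
(* One order higher: the derivative of [g] is a first order remainder of [f1]. *)
pose g y := f y - (f1 x * y + f2 x * ((y - x) ^+ 2 / 2)).
have -> : f (x + D) - f x - D * f1 x - D ^+ 2 / 2 * f2 x = g (x + D) - g x.
  by rewrite /g; field.
have := @mvt_le g (fun y => f1 y - f1 x - (y - x) * f2 x) x D (B * `|D| ^+ 2).
rewrite -mulrA -exprSr; apply => u /andP[u0 u1].
  have h (y : R) : is_derive y 1 (fun y => (y - x) ^+ 2 / 2) (y - x).
    apply: (is_derive_eq (is_derive1_mul (is_derive1_exp 2 (is_derive1_sub
      (is_derive1_id y) (is_derive1_cst x y))) (is_derive1_cst 2^-1 y))).
    by rewrite /=; field.
  apply: (is_derive_eq (is_derive1_sub (hd _) (is_derive1_add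
   (is_derive1_mull (f1 x) (is_derive1_id _)) (is_derive1_mull (f2 x) (h _))))).
  ring.
rewrite [X in X * f2 x]addrAC subrr add0r.
have := @taylor1_le f1 f2 f3 x (u * D) B (fun _ _ => hd1 _) (fun _ _ => hd2 _)
  (fun _ _ => hB _).
move/le_trans; apply; rewrite ler_wpM2l// lerXn2r ?nnegrE//.
by rewrite normrM ger0_norm// ler_piMl.
Qed.

End TaylorBounds.

(** * Expectations as finite sums over paths *)

Section PathExpectation.
Context {R : realType} {d : measure_display} {Omega : measurableType d}.
Variables (P : probability Omega R) (S : finType) (Q : nat -> S -> S -> R).
Variable X : nat -> Omega -> S.
Hypothesis hX : markov_chain P Q X.
Variables (x0 : S) (pay : S -> S -> R).

Definition path_upto n (om : Omega) : n.+1.-tuple S :=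
  [tuple X k om | k < n.+1].

(** [x0] is the default value of [nth], never reached for [k <= n]. *)
Lemma nth_path_upto n om k : (k <= n)%N -> nth x0 (path_upto n om) k = X k om.
Proof.
move=> kn; rewrite (_ : k = Ordinal (kn : (k < n.+1)%N) :> nat)//.
by rewrite -tnth_nth tnth_mktuple.
Qed.

Lemma path_upto_event n (t : n.+1.-tuple S) :
  [set om | path_upto n om = t] =
  [set om | forall k, (k <= n)%N -> X k om = nth x0 t k].
Proof.
apply/seteqP; split => om /=.
  by move=> <- k kn; rewrite nth_path_upto.
move=> h; apply: eq_from_tnth => k.
by rewrite (tnth_nth x0) nth_path_upto -1?ltnS// (tnth_nth x0) h -1?ltnS.
Qed.

Lemma measurable_path_upto n (t : n.+1.-tuple S) :
  measurable [set om | path_upto n om = t].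
Proof.
rewrite path_upto_event.
rewrite (_ : [set om | _] =
  \bigcap_(k in [set k | (k <= n)%N]) [set om | X k om = nth x0 t k])//.
by apply: bigcap_measurable => [|k _]; [exists 0%N|exact: hX.1].
Qed.

Definition path_prob n (t : n.+1.-tuple S) : R :=
  fine (P [set om | path_upto n om = t]).

Lemma path_prob_ge0 n t : 0 <= @path_prob n t.
Proof. exact: fine_ge0. Qed.

Lemma path_upto_pred_event n (A : pred (n.+1.-tuple S)) :
  [set om | A (path_upto n om)] =
  \bigcup_(t in [set` [seq t <- enum {: n.+1.-tuple S} | A t]])
    [set om | path_upto n om = t].
Proof.
apply/seteqP; split => [om /= h|om [t /=]].
  by exists (path_upto n om) => //=; rewrite mem_filter h mem_enum.
by rewrite mem_filter => /andP[At _] ->.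
Qed.

Lemma measurable_path_pred n (A : pred (n.+1.-tuple S)) :
  measurable [set om | A (path_upto n om)].
Proof.
rewrite path_upto_pred_event; apply: fin_bigcup_measurable => // t _.
exact: measurable_path_upto.
Qed.

Lemma prob_path_pred n (A : pred (n.+1.-tuple S)) :
  P [set om | A (path_upto n om)] = (\sum_(t | A t) path_prob t)%:E.
Proof.
rewrite path_upto_pred_event measure_fin_bigcup//; last 2 first.
- by apply/trivIsetP => t t' _ _ /eqP tt'; apply/seteqP; split => // om /= [->].
- by move=> t _; exact: measurable_path_upto.
rewrite -fsbig_seq ?filter_uniq -?enumT ?enum_uniq// big_filter big_enum_cond/= -sumEFin.
apply: eq_bigr => t _; rewrite fineK// fin_num_measure//.
exact: measurable_path_upto.
Qed.

(** The one place where the Markov property itself is applied. *)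
Lemma path_prob_rcons n (t : n.+1.-tuple S) j :
  path_prob [tuple of rcons t j] = path_prob t * Q n (nth x0 t n) j.
Proof.
rewrite /path_prob !path_upto_event.
have e k : (k <= n)%N -> nth x0 (rcons t j) k = nth x0 t k.
  by move=> kn; rewrite nth_rcons size_tuple ltnS kn.
have en : nth x0 (rcons t j) n.+1 = j.
  by rewrite nth_rcons size_tuple ltnn eqxx.
rewrite (hX.2 n (nth x0 (rcons t j))) en e// fineM ?fin_num_measure//.
- congr (fine (P _) * _); apply/seteqP; split => om /= h k kn.
    by rewrite h// e.
  by rewrite h// e.
- rewrite (_ : [set om | _] = [set om | path_upto n om = t]).
    exact: measurable_path_upto.
  rewrite path_upto_event; apply/seteqP; split => om /= h k kn.
    by rewrite h// e.
  by rewrite h// e.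
Qed.

Lemma big_tuple_rcons n (F : n.+2.-tuple S -> R) :
  \sum_t F t = \sum_(t : n.+1.-tuple S) \sum_j F [tuple of rcons t j].
Proof.
rewrite pair_bigA/=.
rewrite (reindex (fun p : n.+1.-tuple S * S => [tuple of rcons p.1 p.2]))//.
apply: onW_bij; apply: inj_card_bij.
  by move=> [t j] [t' j'] /(congr1 val)/= /rcons_inj[/val_inj -> ->].
by rewrite card_prod !card_tuple mulnC -expnS.
Qed.

Definition path_payoff n (t : n.+1.-tuple S) : R :=
  \sum_(k < n) pay (nth x0 t k) (nth x0 t k.+1).

(* The expectation of [f X_n S_n], where [S_n] is the accumulated payoff. *)
Definition expect n (f : S -> R -> R) : R :=
  \sum_(t : n.+1.-tuple S) path_prob t * f (nth x0 t n) (path_payoff t).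

(** Moves the last step from the law to the test function, so that identities valid in each state,
    such as the Poisson equations, apply whatever the law of [X n]. *)
Lemma expect_step n f :
  expect n.+1 f =
  expect n (fun i x => \sum_j Q n i j * f j (x + pay i j)).
Proof.
rewrite /expect big_tuple_rcons; apply: eq_bigr => t _.
rewrite mulr_sumr; apply: eq_bigr => j _.
rewrite path_prob_rcons -mulrA; congr (_ * (_ * f _ _)).
  by rewrite nth_rcons size_tuple ltnn eqxx.
rewrite /path_payoff big_ord_recr/=; congr (_ + pay _ _).
- apply: eq_bigr => k _; congr pay; rewrite nth_rcons size_tuple ltnS.
    by rewrite ltnW.
  by rewrite ltn_ord.
- by rewrite nth_rcons size_tuple ltnS leqnn.
- by rewrite nth_rcons size_tuple ltnn eqxx.
Qed.

Lemma payoff_event n (B : pred R) :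
  [set om | B (\sum_(k < n) pay (X k om) (X k.+1 om))] =
  [set om | B (path_payoff (path_upto n om))].
Proof.
apply/funext => om /=; congr (is_true (B _)).
by apply: eq_bigr => k _; rewrite !nth_path_upto// ltnW.
Qed.

Lemma prob_payoff n (B : pred R) :
  P [set om | B (\sum_(k < n) pay (X k om) (X k.+1 om))] =
  (expect n (fun _ x => (B x)%:R))%:E.
Proof.
rewrite payoff_event (prob_path_pred (fun t => B (path_payoff t))).
congr EFin; rewrite /expect big_mkcond; apply: eq_bigr => t _.
by case: ifP; rewrite (mulr1, mulr0).
Qed.

Lemma measurable_payoff n (B : pred R) :
  measurable [set om | B (\sum_(k < n) pay (X k om) (X k.+1 om))].
Proof.
by rewrite payoff_event; exact: (measurable_path_pred (fun t => B (path_payoff t))).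
Qed.

Lemma expect_cst n c : expect n (fun _ _ => c) = c.
Proof.
rewrite /expect -mulr_suml.
have := prob_path_pred (fun _ : n.+1.-tuple S => true).
rewrite (_ : [set om | _] = setT); last exact/seteqP.
by rewrite probability_setT => -[<-]; rewrite mul1r.
Qed.

Lemma le_expect n f g : (forall i x, f i x <= g i x) -> expect n f <= expect n g.
Proof. by move=> h; apply: ler_sum => t _; rewrite ler_wpM2l ?path_prob_ge0. Qed.

Lemma expectD n f g :
  expect n (fun i x => f i x + g i x) = expect n f + expect n g.
Proof. by rewrite /expect -big_split; apply: eq_bigr => t _; rewrite mulrDr. Qed.

Lemma expectB n f g :
  expect n (fun i x => f i x - g i x) = expect n f - expect n g.
Proof. by rewrite /expect -sumrB; apply: eq_bigr => t _; rewrite mulrBr. Qed.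

Lemma expectZ n c f : expect n (fun i x => c * f i x) = c * expect n f.
Proof. by rewrite /expect mulr_sumr; apply: eq_bigr => t _; rewrite mulrCA. Qed.

Lemma expect_norm_le n f g :
  (forall i x, `|f i x| <= g i x) -> `|expect n f| <= expect n g.
Proof.
move=> h; apply: le_trans (ler_norm_sum _ _ _) _; apply: ler_sum => t _.
by rewrite normrM (ger0_norm (path_prob_ge0 _)) ler_wpM2l ?path_prob_ge0.
Qed.

Lemma expect0E f : expect 0 f = expect 0 (fun i _ => f i 0).
Proof. by apply: eq_bigr => t _; rewrite /path_payoff big_ord0. Qed.

End PathExpectation.

(** * Corrected quadratic and smoothed functionals of the centred sum *)

Section LimitTheorems.
Context {R : realType} {d : measure_display} {Omega : measurableType d}.
Variables (P : probability Omega R) (S : finType) (Q : nat -> S -> S -> R).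
Variable X : nat -> Omega -> S.
Hypothesis hX : markov_chain P Q X.
Variables (x0 : S) (pay : S -> S -> R).
Hypothesis Q_ge0 : forall k i j, 0 <= Q k i j.
Hypothesis Q_sum1 : forall k i, \sum_j Q k i j = 1.

(* [g] solves the Poisson equation of the centred payoffs, and [q] the one of
   the resulting conditional variances; [v] is the asymptotic variance and the
   centring [c k] has average [mu]. *)
Variables (c : nat -> R) (mu v K : R) (g q : nat -> S -> R).
Hypothesis pay_le : forall k i j, `|pay i j - c k| <= K.
Hypothesis g_le : forall k i, `|g k i| <= K.
Hypothesis q_le : forall k i, `|q k i| <= K.
Hypothesis c_mean : forall n, `|\sum_(k < n) c k - n%:R * mu| <= K.
Hypothesis g_poisson : forall k i,
  \sum_j Q k i j * (pay i j - c k + g k.+1 j) = g k i.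
Hypothesis q_poisson : forall k i,
  \sum_j Q k i j * ((pay i j - c k) ^+ 2 / 2 + (pay i j - c k) * g k.+1 j
                    + q k.+1 j) = q k i + v / 2.

Local Notation E := (@expect R d Omega P S X x0 pay).
Let C n := \sum_(k < n) c k.

Let K_ge0 : 0 <= K.
Proof. exact: le_trans (normr_ge0 _) (g_le 0 x0). Qed.

(** After one step, expand in powers of [y = x - C n]: the coefficient of [y] averages to [g] by the
    first Poisson equation, the constant term to [q + v / 2] by the second. *)
Lemma expect_quadratic n :
  E n (fun i x => (x - C n) ^+ 2 / 2 + g n i * (x - C n) + q n i) =
  E 0 (fun i _ => q 0 i) + n%:R * v / 2.
Proof.
elim: n => [|n IHn].
  rewrite expect0E mul0r mul0r addr0; apply: eq_bigr => t _.
  by rewrite /C big_ord0 subrr expr0n !mul0r mulr0 !add0r.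
rewrite (expect_step hX).
rewrite (_ : (fun i x => _) = fun i x =>
   ((x - C n) ^+ 2 / 2 + g n i * (x - C n) + q n i) + v / 2).
  by rewrite expectD IHn (expect_cst hX) -natr1; field.
apply/funext => i; apply/funext => x.
pose y := x - C n; rewrite -/y.
have eC j : x + pay i j - C n.+1 = y + (pay i j - c n).
  by rewrite /y /C big_ord_recr/=; ring.
transitivity (\sum_j (y ^+ 2 / 2 * Q n i j +
    y * (Q n i j * (pay i j - c n + g n.+1 j)) + Q n i j *
    ((pay i j - c n) ^+ 2 / 2 + (pay i j - c n) * g n.+1 j + q n.+1 j))).
  by apply: eq_bigr => j _; rewrite eC; field.
by rewrite !big_split/= -!mulr_sumr Q_sum1 g_poisson q_poisson; ring.
Qed.

Lemma variance_linear : exists M : R, 0 <= M /\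
  forall n, E n (fun _ x => (x - n%:R * mu) ^+ 2) <= M * n.+1%:R.
Proof.
exists (16 * K + 10 * K ^+ 2 + 4 * `|v|); split.
  by rewrite !addr_ge0 ?mulr_ge0 ?sqr_ge0.
move=> n.
pose F i x := (x - C n) ^+ 2 / 2 + g n i * (x - C n) + q n i.
(* With [z = x - C n], [(z / 2 + g)^2 >= 0] gives [8 F >= 2 z^2 - 8 K^2 - 8 K], while
   [(x - n mu)^2 <= 2 z^2 + 2 K^2]. *)
apply: (@le_trans _ _ (E n (fun i x => 8 * F i x + (10 * K ^+ 2 + 8 * K)))).
  apply: le_expect => i x; rewrite /F.
  have := g_le n i; have := q_le n i; have := c_mean n.
  rewrite -/(C n) !ler_norml => /andP[c1 c2] /andP[q1 q2] /andP[g1 g2].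
  have h1 : 0 <= (K - (C n - n%:R * mu)) * (K + (C n - n%:R * mu)).
    by apply: mulr_ge0; lra.
  have h2 : 0 <= (K - g n i) * (K + g n i) by apply: mulr_ge0; lra.
  have h3 := sqr_ge0 ((x - C n) / 2 + g n i).
  have h4 := sqr_ge0 ((x - C n) - (C n - n%:R * mu)).
  nra.
rewrite expectD expectZ (expect_cst hX) expect_quadratic.
have hq : E 0 (fun i _ => q 0 i) <= K.
  rewrite -[leRHS](expect_cst hX x0 pay 0); apply: le_expect => i _.
  by apply: le_trans (q_le 0 i); rewrite ler_norm.
have hv : n%:R * v <= n%:R * `|v| by rewrite ler_wpM2l// ler_norm.
rewrite -natr1.
have n0 : 0 <= n%:R :> R by [].
have h1 : 0 <= n%:R * K by rewrite mulr_ge0.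
have h2 : 0 <= n%:R * K ^+ 2 by rewrite mulr_ge0// sqr_ge0.
have := normr_ge0 v; lra.
Qed.

Section Smoothed.
Variables (eps a B : R).
Hypothesis eps_gt0 : 0 < eps.
Hypothesis v_ge0 : 0 <= v.
Hypothesis DPhi_le : forall k z, (k <= 4)%N -> `|DPhi k z| <= B.
Let rho : R := (Num.sqrt eps)^-1.
(** Coefficients of the third and fourth derivatives in the error of one step: the first three terms
    of [C3] come from the move in space, the rest from the move in time. *)
Let C3 := K ^+ 3 + K * K ^+ 2 + K * K + K * (v / 2).
Let C4 := v ^+ 2 / 4 + K * (v / 2).

Let U k t x := heat eps a k t x.
(** Heat time [v (n - k)] is the variance still to come: it is 0 at [k = n], where the smoothed test
    function of the sum appears, and [v n] at [k = 0], where its Gaussian value does. *)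
Let F n k (i : S) (x : R) :=
  U 0 (v * (n - k)%:R) (x - C k) + g k i * U 1 (v * (n - k)%:R) (x - C k)
  + q k i * U 2 (v * (n - k)%:R) (x - C k).

Let U_le k t x : (k <= 4)%N -> 0 <= t -> `|U k t x| <= B * rho ^+ k.
Proof. by move=> k4 t0; apply: heat_le => // z; exact: DPhi_le. Qed.

Let err := B * (C3 * rho ^+ 3 + C4 * rho ^+ 4).

(** Each term is expanded until the third derivative appears: [U 0] to order two, [U 1] to order
    one, [U 2] to order zero. *)
Let space_step t j k y D : 0 <= t -> `|D| <= K ->
  `|(U 0 t (y + D) + g k.+1 j * U 1 t (y + D) + q k.+1 j * U 2 t (y + D))
    - (U 0 t y + (D + g k.+1 j) * U 1 t y
       + (D ^+ 2 / 2 + D * g k.+1 j + q k.+1 j) * U 2 t y)|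
  <= B * rho ^+ 3 * (K ^+ 3 + K * K ^+ 2 + K * K).
Proof.
move=> t0 hD.
have u3 z : `|U 3 t z| <= B * rho ^+ 3 by apply: U_le.
have B0 : 0 <= B * rho ^+ 3 by exact: le_trans (normr_ge0 _) (u3 0).
have du (l : nat) (z : R) : is_derive z 1 (U l t) (U l.+1 t z).
  exact: is_derive_heat_space.
have e2 := @taylor2_le _ _ _ _ _ y D _ (du 0%N) (du 1%N) (du 2%N) u3.
have e1 := @taylor1_le _ _ _ _ y D _ (fun _ _ => du 1%N _) (fun _ _ => du 2%N _)
  (fun _ _ => u3 _).
have e0 := @mvt_le _ _ _ y D _ (fun _ _ => du 2%N _) (fun _ _ => u3 _).
rewrite [X in `|X|](_ : _ =
  (U 0 t (y + D) - U 0 t y - D * U 1 t y - D ^+ 2 / 2 * U 2 t y) +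
  g k.+1 j * (U 1 t (y + D) - U 1 t y - D * U 2 t y) +
  q k.+1 j * (U 2 t (y + D) - U 2 t y)); last by field.
rewrite [leRHS]mulrDr [X in _ <= X + _]mulrDr.
apply: le_trans (ler_normD _ _) _; apply: lerD.
  apply: le_trans (ler_normD _ _) _; apply: lerD.
    by apply: le_trans e2 _; rewrite ler_wpM2l// lerXn2r ?nnegrE.
  rewrite normrM [leRHS]mulrCA; apply: ler_pM => //.
  by apply: le_trans e1 _; rewrite ler_wpM2l// lerXn2r ?nnegrE.
rewrite normrM [leRHS]mulrCA; apply: ler_pM => //.
by apply: le_trans e0 _; rewrite ler_wpM2l.
Qed.

(** By the heat equation the drift [v / 2] on [U 2] is the first order time increment of [U 0]; what
    remains involves [U 3] and [U 4]. *)
Let time_step t i k y : 0 <= t ->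
  `|(U 0 t y + g k i * U 1 t y + (q k i + v / 2) * U 2 t y)
    - (U 0 (t + v) y + g k i * U 1 (t + v) y + q k i * U 2 (t + v) y)|
  <= B * rho ^+ 3 * (K * (v / 2)) + B * rho ^+ 4 * C4.
Proof.
move=> t0.
have tu u : 0 <= u <= 1 -> 0 <= t + u * v.
  by move=> /andP[u0 _]; rewrite addr_ge0// mulr_ge0.
have du l (u : R) : 0 <= u <= 1 ->
    is_derive (t + u * v) 1 (fun s => U l s y) (U l.+2 (t + u * v) y / 2).
  by move=> hu; apply: is_derive_heat_time => //; exact: tu.
have ub l (u : R) : 0 <= u <= 1 -> (l <= 2)%N ->
    `|U l.+2 (t + u * v) y / 2| <= B * rho ^+ l.+2 / 2.
  move=> hu l2; rewrite normrM [`|2^-1|]ger0_norm ?invr_ge0// ler_wpM2r ?invr_ge0//.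
  by apply: U_le => //; exact: tu.
have e1 := @mvt_le _ (fun s => U 1 s y) (fun s => U 3 s y / 2) t v _ (du 1%N)
  (fun u hu => ub 1%N u hu isT).
have e2 := @mvt_le _ (fun s => U 2 s y) (fun s => U 4 s y / 2) t v _ (du 2%N)
  (fun u hu => ub 2%N u hu isT).
have e0 := @taylor1_le _ (fun s => U 0 s y) (fun s => U 2 s y / 2)
  (fun s => U 4 s y / 4) t v (B * rho ^+ 4 / 4) (du 0%N).
have {}e0 : `|U 0 (t + v) y - U 0 t y - v * (U 2 t y / 2)|
    <= B * rho ^+ 4 / 4 * `|v| ^+ 2.
  apply: e0 => u hu.
    apply: (is_derive_eq (is_derive1_mul (du 2%N u hu) (is_derive1_cst 2^-1 _))).
    by field.
  rewrite normrM [`|4^-1|]ger0_norm ?invr_ge0// ler_wpM2r ?invr_ge0//.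
  by apply: U_le => //; exact: tu.
rewrite (ger0_norm v_ge0) in e0 e1 e2.
rewrite [X in `|X|](_ : _ = - ((U 0 (t + v) y - U 0 t y - v * (U 2 t y / 2)) +
  g k i * (U 1 (t + v) y - U 1 t y) + q k i * (U 2 (t + v) y - U 2 t y)));
  last by field.
rewrite normrN.
rewrite [leRHS](_ : _ = B * rho ^+ 4 / 4 * v ^+ 2 +
  K * (B * rho ^+ 3 / 2 * v) + K * (B * rho ^+ 4 / 2 * v)); last first.
  by rewrite /C4; field.
apply: le_trans (ler_normD _ _) _; apply: lerD.
  apply: le_trans (ler_normD _ _) _; apply: lerD => //.
  by rewrite normrM; apply: ler_pM.
by rewrite normrM; apply: ler_pM.
Qed.

Let one_step n k i x : (k < n)%N ->
  `|\sum_j Q k i j * F n k.+1 j (x + pay i j) - F n k i x| <= err.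
Proof.
move=> kn.
pose t := v * (n - k.+1)%:R; pose y := x - C k.
have t0 : 0 <= t by rewrite mulr_ge0.
have tv : v * (n - k)%:R = t + v.
  by rewrite /t -[in LHS](subnSK kn) -natr1; ring.
(* The second order expansion about [y]: averaged over [j], its coefficients are the left-hand sides
   of the two Poisson equations. *)
pose T j := U 0 t y + (pay i j - c k + g k.+1 j) * U 1 t y
       + ((pay i j - c k) ^+ 2 / 2 + (pay i j - c k) * g k.+1 j + q k.+1 j) * U 2 t y.
have eT : \sum_j Q k i j * T j =
    U 0 t y + g k i * U 1 t y + (q k i + v / 2) * U 2 t y.
  transitivity (\sum_j (Q k i j * U 0 t y +
     Q k i j * (pay i j - c k + g k.+1 j) * U 1 t y + Q k i j *
    ((pay i j - c k) ^+ 2 / 2 + (pay i j - c k) * g k.+1 j + q k.+1 j) * U 2 t y)).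
    by apply: eq_bigr => j _; rewrite /T; ring.
  by rewrite !big_split/= -!mulr_suml Q_sum1 g_poisson q_poisson mul1r.
rewrite (_ : _ - _ = \sum_j Q k i j * (F n k.+1 j (x + pay i j) - T j) +
    ((U 0 t y + g k i * U 1 t y + (q k i + v / 2) * U 2 t y) - F n k i x)); last first.
  rewrite -eT; under [in RHS]eq_bigr => j _ do rewrite mulrBr.
  by rewrite sumrB; ring.
apply: (@le_trans _ _ (B * rho ^+ 3 * (K ^+ 3 + K * K ^+ 2 + K * K) +
  (B * rho ^+ 3 * (K * (v / 2)) + B * rho ^+ 4 * C4))); last first.
  by rewrite /err /C3 le_eqVlt; apply/orP; left; apply/eqP; ring.
apply: le_trans (ler_normD _ _) _; apply: lerD; last first.
  by rewrite /F tv; exact: time_step.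
apply: le_trans (ler_norm_sum _ _ _) _.
set b := (X in _ <= X); rewrite -[leRHS]mul1r -(Q_sum1 k i) mulr_suml.
apply: ler_sum => j _; rewrite normrM (ger0_norm (Q_ge0 _ _ _)) ler_wpM2l//.
have eC : x + pay i j - C k.+1 = y + (pay i j - c k).
  by rewrite /y /C big_ord_recr/=; ring.
by rewrite /F eC; exact: space_step.
Qed.

(** The one-step errors telescope. Dropping the correctors costs [K (rho + rho^2)] up to [B] at each
    end, and replacing [C n] by [n mu] costs one more [K rho]. *)
Lemma smoothed_clt_bound n :
  `|E n (fun _ x => heat eps a 0 0 (x - n%:R * mu)) - heat eps a 0 (v * n%:R) 0|
  <= B * (K * (3 * rho + 2 * rho ^+ 2) + n%:R * (C3 * rho ^+ 3 + C4 * rho ^+ 4)).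
Proof.
have B0 : 0 <= B by exact: le_trans (normr_ge0 _) (DPhi_le 0 (leq0n 4)).
have rho0 : 0 <= rho by rewrite invr_ge0 sqrtr_ge0.
have Br l : 0 <= B * rho ^+ l by rewrite mulr_ge0// exprn_ge0.
have steps m : (m <= n)%N -> `|E m (F n m) - E 0 (F n 0)| <= m%:R * err.
  elim: m => [|m IHm] mn; first by rewrite subrr normr0 mul0r.
  rewrite (expect_step hX) -[E m _](subrK (E m (F n m))) -addrA -natr1 mulrDl addrC.
  apply: le_trans (ler_normD _ _) _; apply: lerD; first exact/IHm/ltnW.
  rewrite mul1r -expectB -[leRHS](expect_cst hX x0 pay m).
  by apply: expect_norm_le => i x; exact: one_step.
have corr k i y t : 0 <= t ->
   `|g k i * U 1 t y + q k i * U 2 t y| <= K * (B * rho) + K * (B * rho ^+ 2).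
  move=> t0; apply: le_trans (ler_normD _ _) _; apply: lerD; rewrite normrM;
    apply: ler_pM => //; first by rewrite -[rho]expr1; exact: U_le.
  exact: U_le.
have first_le : `|E 0 (F n 0) - heat eps a 0 (v * n%:R) 0| <=
    K * (B * rho) + K * (B * rho ^+ 2).
  rewrite -[in X in X <= _](expect_cst hX x0 pay 0 (heat _ _ _ _ _)) -expectB expect0E.
  rewrite -[leRHS](expect_cst hX x0 pay 0).
  apply: expect_norm_le => i _; rewrite /F /C big_ord0 subr0 subn0.
  rewrite [X in `|X|](_ : _ = g 0 i * U 1 (v * n%:R) 0 + q 0 i * U 2 (v * n%:R) 0);
    last by rewrite /U; ring.
  by apply: corr; rewrite mulr_ge0.
have last_le : `|E n (fun _ x => heat eps a 0 0 (x - n%:R * mu)) - E n (F n n)|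
    <= K * (B * rho) + (K * (B * rho) + K * (B * rho ^+ 2)).
  rewrite -expectB -[leRHS](expect_cst hX x0 pay n).
  apply: expect_norm_le => i x; rewrite /F subnn mulr0.
  rewrite [X in `|X|](_ : _ = (U 0 0 (x - n%:R * mu) - U 0 0 (x - C n)) -
    (g n i * U 1 0 (x - C n) + q n i * U 2 0 (x - C n))); last by rewrite /U; ring.
  apply: le_trans (ler_normB _ _) _; apply: lerD.
    have h := @mvt_le _ _ _ (x - C n) (C n - n%:R * mu) _
      (fun _ _ => is_derive_heat_space eps a 0 0 _)
      (fun _ _ => @U_le 1 0 _ isT (lexx _)).
    rewrite (_ : x - C n + _ = x - n%:R * mu) in h; last ring.
    apply: le_trans h _; rewrite expr1 mulrC; apply: ler_wpM2r; last exact: c_mean.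
    by have := Br 1%N; rewrite expr1.
  exact: corr.
have := steps n (leqnn n).
have split3 (x y z w : R) : `|x - w| <= `|x - y| + (`|y - z| + `|z - w|).
  rewrite (_ : x - w = (x - y) + ((y - z) + (z - w))); last ring.
  by rewrite (le_trans (ler_normD _ _))// lerD2l ler_normD.
move=> hs; apply: le_trans (split3 _ (E n (F n n)) (E 0 (F n 0)) _) _.
apply: le_trans (lerD last_le (lerD hs first_le)) _.
by rewrite /err le_eqVlt; apply/orP; left; apply/eqP; ring.
Qed.

End Smoothed.
End LimitTheorems.

(** * Removal of the smoothing *)

Section CentralLimit.
Context {R : realType} {d : measure_display} {Omega : measurableType d}.
Variables (P : probability Omega R) (S : finType) (Q : nat -> S -> S -> R).
Variable X : nat -> Omega -> S.
Hypothesis hX : markov_chain P Q X.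
Variables (x0 : S) (pay : S -> S -> R) (mu v B K C3 C4 : R).
Hypothesis v_gt0 : 0 < v.
Hypotheses (B_ge0 : 0 <= B) (K_ge0 : 0 <= K) (C3_ge0 : 0 <= C3) (C4_ge0 : 0 <= C4).
Local Notation E := (@expect R d Omega P S X x0 pay).
Hypothesis smoothed : forall eps a n, 0 < eps -> let rho := (Num.sqrt eps)^-1 in
  `|E n (fun _ x => heat eps a 0 0 (x - n%:R * mu)) - heat eps a 0 (v * n%:R) 0|
  <= B * (K * (3 * rho + 2 * rho ^+ 2) + n%:R * (C3 * rho ^+ 3 + C4 * rho ^+ 4)).

Let W n (x : R) := (x - n%:R * mu) / Num.sqrt (n%:R * v).

(** Take [eps = e^2 n v]. By scaling the Gaussian value no longer depends on [n], and
    [n rho^2 = 1 / (e^2 v)] is constant, so the whole error is of order [rho]. *)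
Lemma smoothed_cvg (e a eta : R) : 0 < e -> 0 < eta ->
  \forall n \near \oo,
    `|E n (fun _ x => Phi ((a - W n x) / e)) - Phi (a / Num.sqrt (1 + e ^+ 2))| <= eta.
Proof.
move=> e0 eta0.
(* The 5 bounds [3 + 2 rho] once [rho <= 1]. *)
pose M := B * (5 * K + (C3 + C4) / (e ^+ 2 * v)).
have ev0 : 0 < e ^+ 2 * v by rewrite mulr_gt0// exprn_gt0.
have M0 : 0 <= M by rewrite mulr_ge0// addr_ge0 ?mulr_ge0 ?addr_ge0// invr_ge0 ltW.
(* Target size of [rho]; [M + 1] keeps the divisor positive even if [M = 0]. *)
pose dl := Num.min 1 (eta / (M + 1)).
have dl0 : 0 < dl by rewrite lt_min ltr01 divr_gt0// ltr_wpDl.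
near=> n.
have n0 : (0 < n)%N by near: n; exact: nbhs_infty_gt.
have nR0 : 0 < n%:R :> R by rewrite ltr0n.
have hn : dl ^- 2 / (e ^+ 2 * v) <= n%:R by near: n; exact: nbhs_infty_ger.
have nv0 : 0 < n%:R * v by rewrite mulr_gt0.
pose q := Num.sqrt (n%:R * v).
have q0 : 0 < q by rewrite sqrtr_gt0.
have q2 : q ^+ 2 = n%:R * v by rewrite sqr_sqrtr// ltW.
pose eps := (e * q) ^+ 2.
have eq0 : 0 < e * q by rewrite mulr_gt0.
have eps0 : 0 < eps by rewrite exprn_gt0.
have sqe : Num.sqrt eps = e * q by rewrite sqrtr_sqr gtr0_norm.
have := smoothed (a * q) n eps0; rewrite /= sqe.
set rho := (e * q)^-1 => h.
have rho0 : 0 < rho by rewrite invr_gt0.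
have rho2 : rho ^+ 2 * (n%:R * (e ^+ 2 * v)) = 1.
  rewrite /rho exprVn exprMn q2; field.
  by rewrite !gt_eqF.
have rhodl : rho <= dl.
  rewrite -(@ler_pXn2r _ 2) ?nnegrE ?(ltW rho0) ?(ltW dl0)//.
  move: hn; rewrite ler_pdivrMr// => hn.
  have : rho ^+ 2 * dl ^- 2 <= 1 by rewrite -[leRHS]rho2 ler_wpM2l ?sqr_ge0.
  have d2 : 0 < dl ^+ 2 by exact: exprn_gt0.
  by rewrite ler_pdivrMr// mul1r.
have rho1 : rho <= 1 by rewrite (le_trans rhodl)// ge_min lexx.
have rhoe : rho * (M + 1) <= eta.
  by rewrite -ler_pdivlMr ?ltr_wpDl// (le_trans rhodl)// ge_min lexx orbT.
have eH : heat eps (a * q) 0 (v * n%:R) 0 = Phi (a / Num.sqrt (1 + e ^+ 2)).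
  rewrite /heat /isd expr0 mul1r /=; congr Phi.
  rewrite (_ : eps + _ = q ^+ 2 * (1 + e ^+ 2)); last first.
    by rewrite /eps exprMn q2; ring.
  rewrite sqrtrM ?sqr_ge0// sqrtr_sqr gtr0_norm//.
  by field; rewrite !gt_eqF// sqrtr_gt0 ltr_pwDl// sqr_ge0.
have eW : (fun (i : S) x => heat eps (a * q) 0 0 (x - n%:R * mu)) =
    (fun _ x => Phi ((a - W n x) / e)).
  apply/funext => _; apply/funext => x.
  rewrite /heat /isd expr0 mul1r /= addr0 sqe /W -/q; congr Phi.
  by field; rewrite !gt_eqF.
rewrite eH eW in h; apply: le_trans h _; apply: le_trans rhoe.
have nrho2 : n%:R * rho ^+ 2 = (e ^+ 2 * v)^-1.
  apply: (mulIf (lt0r_neq0 ev0)); rewrite mulVf ?gt_eqF// -[RHS]rho2; ring.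
rewrite (_ : B * _ = rho * (B * (K * (3 + 2 * rho) +
   n%:R * rho ^+ 2 * (C3 + C4 * rho)))); last ring.
rewrite nrho2 ler_pM2l// (@le_trans _ _ M)//; last by rewrite lerDl.
rewrite /M; apply: ler_wpM2l => //; apply: lerD.
  by rewrite mulrC; apply: ler_wpM2r => //; lra.
rewrite mulrC ler_wpM2r ?invr_ge0 ?(ltW ev0)// lerD2l.
by rewrite ler_piMr.
Unshelve. all: by end_near. Qed.

(** The indicator of [W <= x] lies, up to [eta / 3], between [Phi ((x - z e - W) / e)] and
    [Phi ((x + z e - W) / e)] when both tails of [Phi] beyond [z] are below [eta / 3]. The choices
    are made in the order [z], [e], [n], since the smoothing error is controlled for fixed [e]
    only. *)
Lemma payoff_clt (x : R) : (fun n => E n (fun _ y => ((W n y <= x)%R : bool)%:R)) @ \oo --> Phi x.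
Proof.
apply/cvgrPdist_le => eta eta0.
have eta3 : 0 < eta / 3 by rewrite divr_gt0.
have [z1 hz1] := @Phi_small R _ eta3.
have [z2 hz2] := @Phi_large R _ eta3.
pose z := `|z1| + `|z2|.
have hzl : Phi (- z) <= eta / 3.
  apply: le_trans hz1; apply: Phi_nondecreasing; rewrite /z.
  by have := ler_norm (- z1); have := normr_ge0 z2; rewrite normrN; lra.
have hzr : 1 - eta / 3 <= Phi z.
  apply: le_trans hz2 _; apply: Phi_nondecreasing; rewrite /z.
  by have := ler_norm z2; have := normr_ge0 z1; lra.
have cPhi (y : R) : {for y, continuous Phi}.
  apply: differentiable_continuous; apply/derivable1_diffP.
  by have [] := is_derive_Phi y.
have lim_e (w : R) : (fun e => Phi ((x + w * e) / Num.sqrt (1 + e ^+ 2))) @ 0^'+ --> Phi x.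
  have -> : Phi x = Phi ((x + w * 0) / Num.sqrt (1 + 0 ^+ 2)).
    by rewrite mulr0 addr0 expr0n addr0 sqrtr1 divr1.
  apply: cvg_at_right_filter.
  apply: (@cvg_comp _ _ _ (fun e => (x + w * e) / Num.sqrt (1 + e ^+ 2)) Phi); last exact: cPhi.
  apply: cvgM.
    by apply: cvgD; [exact: cvg_cst|apply: cvgM; [exact: cvg_cst|exact: cvg_id]].
  apply: cvgV; first by rewrite expr0n addr0 sqrtr1 oner_eq0.
  apply: (@cvg_comp _ _ _ (fun e => 1 + e ^+ 2) Num.sqrt); last exact: sqrt_continuous.
  by apply: cvgD; [exact: cvg_cst|exact: sqr_continuous].
have /cvgrPdist_le /(_ _ eta3) hl := lim_e (- z).
have /cvgrPdist_le /(_ _ eta3) hr := lim_e z.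
near (0 : R)^'+ => e.
have e0 : 0 < e by near: e; exact: nbhs_right_gt.
have hl2 : `|Phi x - Phi ((x + - z * e) / Num.sqrt (1 + e ^+ 2))| <= eta / 3 by near: e.
have hr2 : `|Phi x - Phi ((x + z * e) / Num.sqrt (1 + e ^+ 2))| <= eta / 3 by near: e.
have sl := @smoothed_cvg e (x + - z * e) _ e0 eta3.
have sr := @smoothed_cvg e (x + z * e) _ e0 eta3.
near=> n.
have sl2 : `|E n (fun _ y => Phi ((x + - z * e - W n y) / e)) -
   Phi ((x + - z * e) / Num.sqrt (1 + e ^+ 2))| <= eta / 3 by near: n.
have sr2 : `|E n (fun _ y => Phi ((x + z * e - W n y) / e)) -
   Phi ((x + z * e) / Num.sqrt (1 + e ^+ 2))| <= eta / 3 by near: n.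
have ub : E n (fun _ y => ((W n y <= x)%R : bool)%:R) <=
    E n (fun _ y => Phi ((x + z * e - W n y) / e)) + eta / 3.
  rewrite -[X in _ + X](expect_cst hX x0 pay n) -expectD; apply: le_expect => _ y.
  have [Wx|_] := lerP (W n y) x; last by rewrite addr_ge0 ?Phi_ge0 ?ltW.
  rewrite -lerBlDr (le_trans hzr)//; apply: Phi_nondecreasing.
  by rewrite ler_pdivlMr//; lra.
have lb : E n (fun _ y => Phi ((x + - z * e - W n y) / e)) - eta / 3 <=
    E n (fun _ y => ((W n y <= x)%R : bool)%:R).
  rewrite -[X in _ - X](expect_cst hX x0 pay n) -expectB; apply: le_expect => _ y.
  have [_|Wx] := lerP (W n y) x; first by rewrite lerBlDr (le_trans (Phi_le1 _))// lerDl ltW.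
  rewrite subr_le0 (le_trans _ hzl)//; apply: Phi_nondecreasing.
  by rewrite ler_pdivrMr//; lra.
move: hl2 hr2 sl2 sr2 ub lb; rewrite !ler_norml.
by move=> /andP[? ?] /andP[? ?] /andP[? ?] /andP[? ?] ? ?; apply/andP; split; lra.
Unshelve. all: by end_near. Qed.

End CentralLimit.

(** * The strong law of large numbers *)

Section StrongLaw.
Context {R : realType}.

(* Between k^4 and (k+1)^4 a sequence with bounded increments moves by O(k^3). *)
Lemma cvg_mean_of_fourth_powers (s : nat -> R) (mu K : R) (k0 : nat) :
  (forall n, `|s n.+1 - s n| <= K) ->
  (forall k, (k0 <= k)%N -> `|s (k ^ 4)%N - (k ^ 4)%:R * mu| <= (k ^ 3)%:R) ->
  (fun n => s n / n%:R) @ \oo --> mu.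
Proof.
move=> hK hk0.
pose y n := s n - n%:R * mu; pose K' := K + `|mu|.
have K0 : 0 <= K by exact: le_trans (normr_ge0 _) (hK 0%N).
have K'0 : 0 <= K' by rewrite addr_ge0.
have hy m j : `|y (m + j)%N - y m| <= K' * j%:R.
  elim: j => [|j IH]; first by rewrite addn0 subrr normr0 mulr0.
  rewrite addnS -[j.+1%:R]natr1 mulrDr mulr1 [leRHS]addrC.
  rewrite (_ : _ - _ = (s (m + j).+1 - s (m + j)%N) - mu + (y (m + j)%N - y m)); last first.
    by rewrite /y -natr1; ring.
  apply: le_trans (ler_normD _ _) _; apply: lerD => //.
  by apply: le_trans (ler_normB _ _) _; rewrite lerD2r.
apply/cvgrPdist_le => eta eta0.
(* [(k+1)^4 - k^4 <= 15 k^3] for [k >= 1]; the leading 1 is the deviation allowed at [k^4]. *)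
pose c := 1 + K' * 15.
have c0 : 0 <= c by rewrite addr_ge0// mulr_ge0.
near \oo%classic => k1.
have k10 : (0 < k1)%N by near: k1; exact: nbhs_infty_gt.
have k1k0 : (k0 <= k1)%N by near: k1; exact: nbhs_infty_ge.
have k1eta : c / eta <= k1%:R by near: k1; exact: nbhs_infty_ger.
near=> n.
have nk1 : (k1 ^ 4 <= n)%N by near: n; exact: nbhs_infty_ge.
have [k [kn nk]] : exists k, (k ^ 4 <= n)%N /\ (n < k.+1 ^ 4)%N.
  have ex : exists k, (k ^ 4 <= n)%N by exists k1.
  have ub k : (k ^ 4 <= n)%N -> (k <= n)%N.
    by move=> h; apply: leq_trans h; case: k => // k; rewrite -[leqLHS]expn1 leq_pexp2l.
  have [k kn kmax] := ex_maxnP ex ub.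
  by exists k; split => //; rewrite ltnNge; apply/negP => /kmax; rewrite ltnn.
have k1k : (k1 <= k)%N.
  by rewrite -ltnS -(@ltn_exp2r _ _ 4)//; exact: leq_ltn_trans nk1 nk.
have k0' : (0 < k)%N by exact: leq_trans k1k.
have n0 : 0 < n%:R :> R by rewrite ltr0n (leq_trans _ nk1)// expn_gt0 k10.
have yn : `|y n| <= c * (k ^ 3)%:R.
  have := hy (k ^ 4)%N (n - k ^ 4)%N; rewrite subnKC// => h1.
  have h2 := hk0 k (leq_trans k1k0 k1k); rewrite -/(y _) in h2.
  have h3 : (n - k ^ 4)%:R <= 15 * (k ^ 3)%:R :> R.
    rewrite -natrM ler_nat leq_subLR ltnW// (leq_trans nk)//.
    have : (0 < k ^ 2)%N by rewrite expn_gt0 k0'.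
    nia.
  rewrite -(subrK (y (k ^ 4)%N) (y n)); apply: le_trans (ler_normD _ _) _.
  rewrite /c mulrDl mul1r addrC; apply: lerD => //.
  by apply: le_trans h1 _; rewrite -mulrA ler_wpM2l.
rewrite distrC (_ : s n / n%:R - mu = y n / n%:R); last first.
  by rewrite /y; field; rewrite gt_eqF.
rewrite normrM normfV (ger0_norm (ltW n0)) ler_pdivrMr//.
apply: le_trans yn _.
rewrite ler_pdivrMr// in k1eta.
have kk : c <= eta * k%:R.
  by apply: le_trans k1eta _; rewrite mulrC ler_wpM2l ?(ltW eta0)// ler_nat.
apply: (@le_trans _ _ (eta * k%:R * (k ^ 3)%:R)); first by rewrite ler_wpM2r.
by rewrite -mulrA -natrM -expnS ler_wpM2l ?(ltW eta0)// ler_nat.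
Unshelve. all: by end_near. Qed.

Context {d : measure_display} {Omega : measurableType d}.
Variables (P : probability Omega R) (S : finType) (Q : nat -> S -> S -> R).
Variable X : nat -> Omega -> S.
Hypothesis hX : markov_chain P Q X.
Variables (x0 : S) (pay : S -> S -> R) (mu K M : R).
Hypothesis pay_le : forall i j, `|pay i j| <= K.
Local Notation E := (@expect R d Omega P S X x0 pay).
Hypothesis M_ge0 : 0 <= M.
Hypothesis variance_le : forall n, E n (fun _ x => (x - n%:R * mu) ^+ 2) <= M * n.+1%:R.

(** Chebyshev at time [k^4] with threshold [k^3] gives [M (k^4 + 1) / k^6 <= 2 M / k^2]. This
    threshold serves every tolerance at once, so a single null set suffices. Indices are shifted to
    keep [k] positive. *)
Lemma payoff_slln : {ae P, forall om,
  (fun n => (\sum_(k < n) pay (X k om) (X k.+1 om)) / n%:R) @ \oo --> mu}.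
Proof.
pose Sn n om := \sum_(k < n) pay (X k om) (X k.+1 om).
pose B k : pred R := fun x => (k.+1 ^ 3)%:R < `|x - (k.+1 ^ 4)%:R * mu|.
pose F k := [set om | B k (Sn (k.+1 ^ 4)%N om)].
have mF k : measurable (F k) by exact: (measurable_payoff hX x0).
have PF k : (P (F k) <= (2 * M * (k.+1%:R ^- 2))%:E)%E.
  rewrite /F (prob_payoff hX x0) lee_fin.
  have k3 : 0 < (k.+1 ^ 3)%:R :> R by rewrite ltr0n expn_gt0.
  apply: (@le_trans _ _ (E (k.+1 ^ 4)%N
     (fun _ x => ((k.+1 ^ 3)%:R ^- 2) * (x - (k.+1 ^ 4)%:R * mu) ^+ 2))).
    apply: le_expect => _ x; rewrite /B; case: ltP => h.
      rewrite mulrC ler_pdivlMr ?exprn_gt0// mul1r -[leRHS]ger0_norm ?sqr_ge0//.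
      by rewrite normrX lerXn2r ?nnegrE// ltW.
    by rewrite mulr_ge0 ?sqr_ge0// invr_ge0 sqr_ge0.
  rewrite expectZ mulrC ler_pdivrMr ?exprn_gt0//.
  apply: le_trans (variance_le _) _.
  have -> : 2 * M * k.+1%:R ^- 2 * (k.+1 ^ 3)%:R ^+ 2 = M * (2 * (k.+1 ^ 4)%:R) :> R.
    have : k.+1%:R != 0 :> R by rewrite pnatr_eq0.
    by rewrite !natrX; move: (k.+1%:R : R) => m m0; field.
  rewrite ler_wpM2l// -natrM ler_nat mul2n -addnn -addn1 leq_add2l.
  by rewrite expn_gt0.
have sumF : (\sum_(k <oo) P (F k) < +oo)%E.
  apply: (@le_lt_trans _ _ ((4 * M)%:E)); last exact: ltry.
  apply: lime_le; first by apply: is_cvg_nneseries.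
  apply: nearW => n.
  apply: (@le_trans _ _ (\sum_(0 <= k < n) (2 * M * (k.+1%:R ^- 2))%:E)%E).
    by apply: lee_sum => k _; exact: PF.
  rewrite sumEFin lee_fin -mulr_sumr.
  (* Telescoping bound from [1 / (k+1)^2 <= 1 / k - 1 / (k+1)]. *)
  have tel m : \sum_(0 <= k < m.+1) (k.+1%:R ^- 2 : R) <= 2 - m.+1%:R^-1.
    elim: m => [|m IH]; first by rewrite big_nat1 expr1n invr1; lra.
    rewrite big_nat_recr//=; apply: le_trans (lerD IH (lexx _)) _.
    have a0 : 0 < m.+1%:R :> R by rewrite ltr0n.
    rewrite -[m.+2%:R]natr1; move: (m.+1%:R : R) a0 => a a0.
    have b0 : 0 < a + 1 by rewrite ltr_wpDr.
    rewrite -subr_ge0 (_ : _ - _ = (a * (a + 1) ^+ 2)^-1).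
      by rewrite invr_ge0 mulr_ge0 ?sqr_ge0 ?ltW.
    by field; rewrite !gt_eqF.
  rewrite (_ : 4 * M = 2 * M * 2); last ring.
  rewrite ler_wpM2l ?mulr_ge0//; case: n => [|m]; first by rewrite big_geq.
  by apply: le_trans (tel m) _; rewrite lerBlDr lerDl invr_ge0.
have null := lim_sup_set_cvg0 mF sumF.
exists (lim_sup_set F); split => //.
  by apply: bigcap_measurable => [|k _]; [exists 0%N|apply: bigcup_measurable].
move=> om /= hom; apply: contrapT => hF; apply: hom => /=.
have {hF} : exists n, forall k, (n <= k)%N -> ~ F k om.
  apply: contrapT => h; apply: hF => n _.
  apply: contrapT => h2; apply: h; exists n => k nk Fk; apply: h2.
  by exists k.
move=> [n hn]; apply: (@cvg_mean_of_fourth_powers (Sn ^~ om) mu K n.+1).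
  by move=> m; rewrite /Sn big_ord_recr/= addrAC subrr add0r.
by move=> [//|k] nk; rewrite leNgt; apply/negP; exact: hn.
Qed.

End StrongLaw.

(** * The fundamental matrix of an ergodic chain *)

Section FundamentalMatrix.
Context {R : realType} {n : nat}.
Variables (Q : 'M[R]_n) (pi0 : 'rV[R]_n).
Local Notation one := (const_mx 1 : 'cV[R]_n).
Hypothesis Q_one : Q *m one = one.
Hypothesis Q_ergodic : ergodic Q.
Hypothesis pi0_stationary : stationary Q pi0.

Lemma row_mul_one (v : 'rV[R]_n) : (v *m one) 0 0 = \sum_i v 0 i.
Proof. by rewrite mxE; apply: eq_bigr => i _; rewrite mxE mulr1. Qed.

Lemma stationary_mul_one : pi0 *m one = 1%:M.
Proof.
apply/matrixP => i j; rewrite !ord1 row_mul_one.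
by rewrite pi0_stationary.1.2 mxE eqxx.
Qed.

(** Ergodicity speaks of distributions; decomposing along point masses extends it linearly to signed
    row vectors. *)
Lemma ergodic_cvg (u : 'rV[R]_n) j :
  (fun k => (u *m Q ^+ k) 0 j) @ \oo --> (\sum_i u 0 i) * pi0 0 j.
Proof.
have [v [_ uniq_v hv]] := Q_ergodic.
rewrite (uniq_v _ pi0_stationary).
have -> : (fun k => (u *m Q ^+ k) 0 j) =
    fun k => \sum_i u 0 i * ((delta_mx 0 i : 'rV[R]_n) *m Q ^+ k) 0 j.
  apply/funext => k; rewrite {1}(row_sum_delta u) mulmx_suml summxE.
  by apply: eq_bigr => i _; rewrite -scalemxAl mxE.
rewrite mulr_suml; apply: cvg_big => [|i _]; first exact: add_continuous.
apply: cvgM; first exact: cvg_cst.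
apply: hv; split => [l|]; first by rewrite mxE ler0n.
rewrite (bigD1 i)//= big1 ?addr0; first by rewrite mxE !eqxx.
by move=> l li; rewrite mxE (negbTE li).
Qed.

Local Notation F := (1%:M - (Q - one *m pi0)).

(** A row vector killed by [F] has zero sum, hence is fixed by [Q], hence equals the limit of its
    own iterates, which is zero. *)
Lemma fundamental_unit : F \in unitmx.
Proof.
rewrite -row_free_unit -kermx_eq0; apply/negPn/negP => /rowV0Pn[u /sub_kermxP uF].
move/eqP; apply; apply/rowP => j.
have u1 : u *m one = 0.
  move: uF => /(congr1 (mulmx^~ one)); rewrite /= -mulmxA !mulmxBl mul0mx mul1mx.
  by rewrite Q_one -mulmxA stationary_mul_one mulmx1 subrr subr0.
have uQ : u *m Q = u.
  move: uF; rewrite !mulmxBr mulmx1 mulmxA u1 mul0mx subr0 => /eqP.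
  by rewrite subr_eq0 => /eqP.
have uQk k : u *m Q ^+ k = u.
  by elim: k => [|k IH]; [rewrite expr0 mulmx1|rewrite exprS mulmxA uQ].
have := @ergodic_cvg u j; rewrite -row_mul_one u1 mxE mul0r.
under eq_fun => k do rewrite uQk.
by move/(cvg_lim (@Rhausdorff _)); rewrite lim_cst// mxE.
Qed.

Local Notation Z := (invmx F).

Lemma Z_one : Z *m one = one.
Proof.
have h : F *m one = one.
  by rewrite !mulmxBl mul1mx Q_one -mulmxA stationary_mul_one mulmx1 subrr subr0.
by rewrite -[RHS](mulKmx fundamental_unit) h.
Qed.

Lemma pi0_Z : pi0 *m Z = pi0.
Proof.
have h : pi0 *m F = pi0.
  rewrite !mulmxBr mulmx1 pi0_stationary.2 mulmxA stationary_mul_one mul1mx.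
  by rewrite subrr subr0.
by rewrite -[RHS](mulmxK fundamental_unit) h.
Qed.

Lemma Zsub_one : (Z - one *m pi0) *m one = 0.
Proof. by rewrite mulmxBl Z_one -mulmxA stationary_mul_one mulmx1 subrr. Qed.

Lemma pi0_Zsub : pi0 *m (Z - one *m pi0) = 0.
Proof. by rewrite mulmxBr pi0_Z mulmxA stationary_mul_one mul1mx subrr. Qed.

(** [Z] preserves the stationary mean, and on vectors of mean zero [F] acts as [1%:M - Q]. *)
Lemma poisson_solution (f : 'cV[R]_n) : pi0 *m f = 0 ->
  let g := (Z - one *m pi0) *m f in Q *m g + f = g.
Proof.
move=> pf g.
have -> : g = Z *m f by rewrite /g mulmxBl -mulmxA pf mulmx0 subr0.
have h : F *m (Z *m f) = f by rewrite mulKVmx ?fundamental_unit.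
rewrite -{2}h !mulmxBl mul1mx -mulmxA (mulmxA pi0) pi0_Z pf mulmx0 subr0.
by rewrite addrC subrK.
Qed.

End FundamentalMatrix.

(** * The Poisson equation with periodic coefficients *)

Section PeriodicPoisson.
Context {R : realType} {n : nat}.
Variables (L : nat) (M : nat -> 'M[R]_n) (pi0 : 'rV[R]_n).
Local Notation one := (const_mx 1 : 'cV[R]_n).
Hypothesis L_gt0 : (0 < L)%N.
Hypothesis M_periodic : forall k, M (k %% L)%N = M k.
Hypothesis M_one : forall k, M k *m one = one.

Fixpoint prefix_mx k : 'M[R]_n :=
  if k is k'.+1 then prefix_mx k' *m M k' else 1%:M.

Lemma prefix_mx_one k : prefix_mx k *m one = one.
Proof. by elim: k => [|k IH] /=; rewrite ?mul1mx// -mulmxA M_one. Qed.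

Hypothesis erg : ergodic (prefix_mx L).
Hypothesis pi0_stationary : stationary (prefix_mx L) pi0.

Local Notation Z := (invmx (1%:M - (prefix_mx L - one *m pi0))).

(** Summing the equation over a period leaves a homogeneous Poisson equation for the value at phase
    0; the other phases follow by running the recursion backwards. *)
Lemma periodic_poisson (b : nat -> 'cV[R]_n) :
  (forall k, b (k %% L)%N = b k) ->
  pi0 *m (\sum_(k < L) prefix_mx k *m b k) = 0 ->
  exists g : nat -> 'cV[R]_n,
  [/\ forall k, g (k %% L)%N = g k, forall k, g k = M k *m g k.+1 + b k &
      g 0%N = (Z - one *m pi0) *m (\sum_(k < L) prefix_mx k *m b k)].
Proof.
move=> b_per; set f := \sum_(k < L) _ => pf.
have [g0 g0def g0E] : exists2 g0, g0 = (Z - one *m pi0) *m f &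
    prefix_mx L *m g0 + f = g0.
  eexists; first reflexivity.
  by apply: poisson_solution => //; exact: prefix_mx_one.
(* [h j] is the corrector at time [L - j], starting from [g0] at the end of the period. *)
pose h := fix h j := if j is j'.+1 then M (L - j)%N *m h j' + b (L - j)%N else g0.
(* At [j = L] this says that the backward recursion returns to [g0], which closes the cycle. *)
have hE j : (j <= L)%N ->
    prefix_mx (L - j)%N *m h j + \sum_(k < L - j) prefix_mx k *m b k = g0.
  elim: j => [|j IH] jL; first by rewrite subn0.
  rewrite -[RHS](IH (ltnW jL)) -(subnSK jL) big_ord_recr/= mulmxDr mulmxA.
  by rewrite -addrA [_ + \sum_(_ < _) _]addrC.
have hL : h L = g0 by have := hE L (leqnn L); rewrite subnn big_ord0 mul1mx addr0.
exists (fun k => h (L - k %% L)%N); split.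
- by move=> k; rewrite modn_mod.
- move=> k; have kL := ltn_pmod k L_gt0.
  rewrite -(subnSK kL) [LHS]/= subnSK// subKn 1?ltnW// M_periodic b_per.
  have -> : (k.+1 %% L = (k %% L).+1 %% L)%N by rewrite -addn1 -modnDml addn1.
  congr (_ *m _ + _).
  move: kL; rewrite leq_eqVlt => /orP[/eqP kL|kL].
    by rewrite kL modnn subn0 subnn hL.
  by rewrite (modn_small kL).
- by rewrite mod0n subn0 hL.
Qed.

End PeriodicPoisson.

Section PeriodicSequences.
Context {R : realType}.
Variables (L : nat) (L_gt0 : (0 < L)%N).

Lemma periodic_bounded n (g : nat -> 'cV[R]_n) : (forall k, g (k %% L)%N = g k) ->
  exists K, forall k i, `|g k i 0| <= K.
Proof.
move=> gp; exists (\sum_(k < L) \sum_i `|g k i 0|) => k i; rewrite -gp.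
rewrite (bigD1 (Ordinal (ltn_pmod k L_gt0)))//= (bigD1 i)//= -addrA lerDl.
by rewrite addr_ge0// sumr_ge0// => j _; rewrite sumr_ge0.
Qed.

(** Complete periods contribute nothing, so only an incomplete one remains. *)
Lemma periodic_mean (c : nat -> R) mu : (forall k, c (k %% L)%N = c k) ->
  \sum_(k < L) c k = L%:R * mu ->
  exists K, forall n, `|\sum_(k < n) c k - n%:R * mu| <= K.
Proof.
move=> cp cL; exists (\sum_(k < L) `|c k - mu|) => n.
have e m : \sum_(k < m) c k - m%:R * mu = \sum_(k < m) (c k - mu).
  by rewrite sumrB sumr_const card_ord mulr_natl.
have e2 q m : \sum_(k < (q * L + m)%N) (c k - mu) = \sum_(k < m) (c k - mu).
  elim: q => [|q IH]; first by rewrite mul0n.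
  rewrite mulSn -addnA big_split_ord/= -[X in X + _]e cL subrr add0r -IH.
  by apply: eq_bigr => k _; rewrite -cp modnDl cp.
rewrite e; have := e2 (n %/ L)%N (n %% L)%N; rewrite -divn_eq => ->.
apply: le_trans (ler_norm_sum _ _ _) _.
have mL : (n %% L <= L)%N by rewrite ltnW// ltn_pmod.
rewrite -!(big_mkord xpredT (fun k => `|c k - mu|)).
by rewrite [leRHS](@big_cat_nat _ _ _ (n %% L)%N)//= lerDl sumr_ge0.
Qed.

End PeriodicSequences.

(** * Stochasticity of the game kernels and their payoffs *)

Section GameKernels.
Context {R : realType} (N : nat).
Hypothesis N_ge3 : (3 <= N)%N.
Variable p : 'I_4 -> R.
Hypothesis p01 : forall m, 0 <= p m <= 1.
Implicit Types a b : state N.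

Let N_neq0 : N%:R != 0 :> R.
Proof. by rewrite pnatr_eq0; case: N N_ge3. Qed.

Let NV_ge0 : 0 <= N%:R^-1 :> R.
Proof. by rewrite invr_ge0. Qed.

Lemma profit_cases (t : profit) : [\/ ssval t = -1, ssval t = 0 | ssval t = 1].
Proof.
have := ssvalP t; rewrite !inE => /or3P[]/eqP ->; by [constructor 1|constructor 2|constructor 3].
Qed.

Lemma sum_profit (G : int -> R) :
  \sum_(t : profit) G (ssval t) = G (-1) + G 0 + G 1.
Proof.
rewrite -(big_map (@ssval _ profits) xpredT G).
rewrite (perm_big profits)/=; last first.
  apply: uniq_perm => //.
    rewrite map_inj_uniq ?index_enum_uniq//; exact: val_inj.
  move=> x; apply/mapP/idP => [[t _ ->]|xp]; first exact: ssvalP.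
  by exists (SeqSub xp) => //; rewrite mem_index_enum.
by rewrite !big_cons big_nil addr0 addrA.
Qed.

Lemma sum_state (G : config N -> int -> R) :
  \sum_(b : state N) G b.1 (ssval b.2) =
  \sum_(zeta : config N) (G zeta (-1) + G zeta 0 + G zeta 1).
Proof.
rewrite -(pair_bigA _ (fun zeta t => G zeta (ssval t)))/=.
by apply: eq_bigr => zeta _; exact: sum_profit.
Qed.

Lemma kernelB_ge0 a b : 0 <= kernelB p a b.
Proof.
case: a b => [eta s] [zeta t]; rewrite /kernelB.
have p0 m : 0 <= p m by have /andP[] := p01 m.
have q0 m : 0 <= 1 - p m by have /andP[] := p01 m; rewrite subr_ge0.
apply: addr_ge0.
  by apply: sumr_ge0 => x _; do !case: ifP => _ //; rewrite mulr_ge0.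
by do !case: ifP => _ //; rewrite mulr_ge0// sumr_ge0.
Qed.

(** Each player accounts for [1 / N]: a win and a loss have weights [p] and [1 - p], one of them
    flipping the status and the other keeping it. *)
Lemma kernelB_sum1 a : \sum_b kernelB p a b = 1.
Proof.
case: a => eta s.
pose f (x : 'I_N) (t : int) : R :=
  if t == 1 then (if ~~ eta x then N%:R^-1 * p (nbhd eta x) else 0)
  else if t == -1 then (if eta x then N%:R^-1 * (1 - p (nbhd eta x)) else 0) else 0.
pose h (t : int) : R :=
  if t == 1 then N%:R^-1 * \sum_(x < N | eta x) p (nbhd eta x)
  else if t == -1 then N%:R^-1 * \sum_(x < N | ~~ eta x) (1 - p (nbhd eta x)) else 0.
pose G (zeta : config N) t :=
  \sum_(x < N | zeta == flip eta x) f x t + (if zeta == eta then h t else 0).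
transitivity (\sum_(b : state N) G b.1 (ssval b.2)).
  by apply: eq_bigr => -[zeta t] _.
rewrite sum_state.
have swap t : \sum_zeta G zeta t = \sum_x f x t + h t.
  rewrite big_split/=; congr (_ + _); last by rewrite -big_mkcond big_pred1_eq.
  rewrite (exchange_big_dep xpredT)//=; apply: eq_bigr => x _.
  by rewrite big_pred1_eq.
(* The share of player [x] in the weight of leaving the configuration unchanged. *)
pose g (x : 'I_N) (t : int) : R :=
  if t == 1 then (if eta x then N%:R^-1 * p (nbhd eta x) else 0)
  else if t == -1 then (if ~~ eta x then N%:R^-1 * (1 - p (nbhd eta x)) else 0) else 0.
have hE t : h t = \sum_x g x t.
  rewrite /h /g; case: (t == 1); first by rewrite mulr_sumr big_mkcond.
  by case: (t == -1); [rewrite mulr_sumr big_mkcond|rewrite big1].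
rewrite big_split big_split !swap !hE -!big_split/=.
have s1 : \sum_(x < N) N%:R^-1 = 1 :> R.
  by rewrite sumr_const card_ord -[N%:R^-1 *+ N]mulr_natr mulVf.
rewrite -[RHS]s1.
apply: eq_bigr => x _; rewrite /f /g/=.
by case: (eta x) => /=; ring.
Qed.

(** The payoff is 1 or -1 wherever game B has positive weight; this is the source of the leading [s]
    in the variance. *)
Lemma kernelB_payoff_sqr a b : kernelB p a b * payoff R a b ^+ 2 = kernelB p a b.
Proof.
case: a b => [eta s] [zeta t]; rewrite /kernelB /payoff.
case: (profit_cases t) => ->.
- rewrite /= !mulrN1z; set c := (_ == eta) || _.
  case: (boolP c) => [_|]; first by rewrite sqrrN expr1n mulr1.
  rewrite negb_or negb_exists => /andP[/negbTE -> /forallP h].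
  rewrite expr0n/= mulr0 addr0 big1// => x zx.
  by have := h x; rewrite zx/=; case: (eta x) => //; rewrite opprK divff ?eqxx// pnatr_eq0.
- by rewrite /= big1// add0r; case: ifP => _; rewrite mul0r.
- rewrite /= mulr1z; set c := (_ == eta) || _.
  case: (boolP c) => [_|]; first by rewrite expr1n mulr1.
  rewrite negb_or negb_exists => /andP[/negbTE -> /forallP h].
  rewrite expr0n/= mulr0 addr0 big1// => x zx.
  by have := h x; rewrite zx/= subrr mul0r; case: (eta x) => //; rewrite eqxx.
Qed.

Lemma payoff_le1 a b : `|payoff R a b| <= 1.
Proof.
case: a b => [eta s] [zeta t]; rewrite /payoff; case: ifP => _; last by rewrite normr0.
by case: (profit_cases t) => ->; rewrite ?normrN ?normr0 ?normr1.
Qed.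

Lemma kernelA'_ge0 a b : 0 <= kernelA' R a b.
Proof.
by case: a b => [eta s] [zeta t]; rewrite /kernelA'; case: ifP.
Qed.

Lemma kernelA'_payoff a b : kernelA' R a b * payoff R a b = 0.
Proof.
case: a b => [eta s] [zeta t]; rewrite /kernelA' /payoff.
by case: (profit_cases t) => ->; rewrite ?mul0r//= mulr0.
Qed.

(** The two neighbours would coincide for [N = 2]. Their being distinct gives each player exactly
    four pairs of neighbour and direction, matching the normalisation [4 N]. *)
Lemma ord_pred_neq_ordS (x : 'I_N) : ord_pred x != ordS x.
Proof.
apply/eqP => /(congr1 val)/=; have := ltn_ord x; case: x => x /= xN _.
have [x0|x0] := eqVneq x 0%N.
  by rewrite x0 add0n !modn_small; move: N_ge3 xN; lia.
have [xl|xl] := eqVneq x.+1 N.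
  by rewrite xl modnn (_ : (x + N).-1 = x.-1 + N)%N ?modnDr ?modn_small; move: N_ge3 xN; lia.
by rewrite (_ : (x + N).-1 = x.-1 + N)%N ?modnDr ?modn_small; move: N_ge3 xN; lia.
Qed.

Lemma kernelA'_sum1 a : \sum_b kernelA' R a b = 1.
Proof.
case: a => eta s.
pose D (u : 'I_N * 'I_N * bool) := u.1.2 \in [:: ord_pred u.1.1; ordS u.1.1].
pose h (u : 'I_N * 'I_N * bool) := transfer eta u.1.1 u.1.2 u.2.
pose G (zeta : config N) (t : int) : R := if t == 0 then
  \sum_u ((D u && (h u == zeta)) : bool)%:R / (4 * N)%:R else 0.
transitivity (\sum_(b : state N) G b.1 (ssval b.2)).
  apply: eq_bigr => -[zeta t] _; rewrite /kernelA' /G/=; case: ifP => // _.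
  rewrite -mulr_suml -sum1_card big_mkcond natr_sum; congr (_ / _).
  by apply: eq_bigr => -[[x y] e] _; rewrite /D /h inE/=; case: ifP.
rewrite sum_state /G/=; under eq_bigr => zeta _ do rewrite add0r addr0.
rewrite exchange_big/=.
transitivity (\sum_(u : 'I_N * 'I_N * bool) (D u)%:R / (4 * N)%:R : R).
  apply: eq_bigr => u _; rewrite -mulr_suml; congr (_ / _).
  rewrite (bigD1 (h u))//= eqxx andbT big1 ?addr0// => zeta.
  by rewrite eq_sym => /negbTE ->; rewrite andbF.
rewrite -mulr_suml -(pair_bigA _ (fun xy (e : bool) => (D (xy, e))%:R))/=.
rewrite -(pair_bigA _ (fun x y => \sum_(e : bool) (D (x, y, e))%:R))/=.
rewrite (eq_bigr (fun=> 4)); last first.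
  move=> x _; rewrite (eq_bigr (fun y => ((y \in [:: ord_pred x; ordS x]) : bool)%:R * 2)).
    rewrite -mulr_suml -natr_sum -big_mkcond/= sum1_card.
    rewrite (card_uniqP _) /=; first by rewrite -natrM.
    by rewrite andbT inE ord_pred_neq_ordS.
  by move=> y _; rewrite big_bool /D/= -mulr2n mulr_natr.
rewrite sumr_const card_ord -[4 *+ N]mulr_natr -natrM divff// pnatr_eq0.
by case: N N_ge3.
Qed.

End GameKernels.

(** * Correctors of the two-block chain and the variance formula *)

Section TwoBlockCorrectors.
Context {R : realType} {n : nat}.
Variables (r s : nat) (A B D : 'M[R]_n) (W : 'I_n -> 'I_n -> R) (pi0 : 'rV[R]_n).
Local Notation one := (const_mx 1 : 'cV[R]_n).
Local Notation L := (r + s)%N.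
Local Notation P := (A ^+ r *m B ^+ s).
Local Notation Z := (invmx (1%:M - (P - one *m pi0))).
Hypothesis s_gt0 : (0 < s)%N.
Hypotheses (A_one : A *m one = one) (B_one : B *m one = one).
Hypothesis AW : forall i j, A i j * W i j = 0.
Hypothesis BW : forall i j, B i j * W i j = D i j.
Hypothesis BWW : forall i j, B i j * W i j ^+ 2 = B i j.
Hypothesis erg : ergodic P.
Hypothesis pi0_stationary : stationary P pi0.

Let m v := (pi0 *m A ^+ r *m B ^+ v *m D *m one) 0 0.

Variables (mu var : R).
Hypothesis muE : mu = L%:R^-1 * \sum_(v < s) m v.
Hypothesis varE : var = L%:R^-1 *
  (s%:R - \sum_(v < s) m v ^+ 2 + 2 *
     (\sum_(v < s) \sum_(u < v)
        (pi0 *m A ^+ r *m B ^+ u *m D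
         *m (B ^+ (v - u - 1) - one *m pi0 *m A ^+ r *m B ^+ v)
         *m D *m one) 0 0
      + \sum_(u < s) \sum_(v < s)
        (pi0 *m A ^+ r *m B ^+ u *m D *m B ^+ (s - u - 1)
         *m (Z - one *m pi0) *m A ^+ r *m B ^+ v
         *m D *m one) 0 0)).

Let L_gt0 : (0 < L)%N. Proof. by rewrite addn_gt0 s_gt0 orbT. Qed.
Let L_neq0 : L%:R != 0 :> R. Proof. by rewrite pnatr_eq0 -lt0n. Qed.

Definition block_mx_at k := if (k %% L < r)%N then A else B.
Let M := block_mx_at.
Let Dm k := if (k %% L < r)%N then 0 else D.

Let B_expS v : B *m B ^+ v = B ^+ v.+1. Proof. by rewrite exprS. Qed.

Let B_expSr v : B ^+ v *m B = B ^+ v.+1. Proof. by rewrite exprSr. Qed.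

Let B_exp_one v : B ^+ v *m one = one.
Proof. by elim: v => [|v IH]; rewrite ?mul1mx// exprS -mulmxA IH. Qed.

Let A_exp_one v : A ^+ v *m one = one.
Proof. by elim: v => [|v IH]; rewrite ?mul1mx// exprS -mulmxA IH. Qed.

Let M_per k : M (k %% L)%N = M k.
Proof. by rewrite /M /block_mx_at modn_mod. Qed.

Let M_one k : M k *m one = one.
Proof. by rewrite /M /block_mx_at; case: ifP. Qed.

Let M_B v : (v < s)%N -> M (r + v)%N = B.
Proof.
by move=> vs; rewrite /M /block_mx_at modn_small ?ltn_add2l// ltnNge leq_addr.
Qed.

Let prefixA k : (k <= r)%N -> prefix_mx M k = A ^+ k.
Proof.
elim: k => [//|k IH] kr /=; rewrite IH ?(ltnW kr)// exprSr /M /block_mx_at.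
by rewrite modn_small ?kr// ltn_addr.
Qed.

Let prefixB v : (v <= s)%N -> prefix_mx M (r + v) = A ^+ r *m B ^+ v.
Proof.
elim: v => [|v IH] vs; first by rewrite addn0 expr0 mulmx1 prefixA.
by rewrite addnS/= IH ?(ltnW vs)// M_B// exprSr mulmxA.
Qed.

Let prefixL : prefix_mx M L = P. Proof. exact: prefixB. Qed.

(** The mean payoff of step [k] when each period starts from [pi0]. *)
Let c k : R := (pi0 *m prefix_mx M (k %% L) *m Dm k *m one) 0 0.

Let c_per k : c (k %% L)%N = c k.
Proof. by rewrite /c /Dm !modn_mod. Qed.

Let cA k : (k < r)%N -> c k = 0.
Proof.
move=> kr; rewrite /c /Dm modn_small ?ltn_addr// kr.
by rewrite mulmx0 mul0mx mxE.
Qed.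

Let cB v : (v < s)%N -> c (r + v) = m v.
Proof.
move=> vs; rewrite /c /Dm modn_small ?ltn_add2l// ltnNge leq_addr/=.
by rewrite prefixB ?(ltnW vs)// !mulmxA.
Qed.

Let c_sum : \sum_(k < L) c k = L%:R * mu.
Proof.
rewrite big_split_ord/= big1 ?add0r; last by move=> k _; rewrite cA.
by rewrite muE mulVKf//; apply: eq_bigr => v _; rewrite cB.
Qed.

Let row_one v : pi0 *m A ^+ r *m B ^+ v *m one = 1%:M.
Proof. by rewrite -!mulmxA B_exp_one A_exp_one (stationary_mul_one pi0_stationary). Qed.

Let b k : 'cV[R]_n := Dm k *m one - c k *: one.

Let bA k : (k < r)%N -> b k = 0.
Proof.
move=> kr; rewrite /b cA// scale0r subr0 /Dm modn_small ?ltn_addr// kr.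
by rewrite mul0mx.
Qed.

Let bB v : (v < s)%N -> b (r + v) = D *m one - m v *: one.
Proof.
by move=> vs; rewrite /b cB// /Dm modn_small ?ltn_add2l// ltnNge leq_addr.
Qed.

Let row_b v : (v < s)%N -> pi0 *m A ^+ r *m B ^+ v *m b (r + v) = 0.
Proof.
move=> vs; rewrite bB// mulmxBr -scalemxAr row_one mulmxA.
by rewrite [X in X - _]mx11_scalar -/(m v) scalemx1 subrr.
Qed.

Let sum_b : \sum_(k < L) prefix_mx M k *m b k =
  \sum_(v < s) A ^+ r *m B ^+ v *m b (r + v).
Proof.
rewrite big_split_ord/= big1 ?add0r; last by move=> k _; rewrite bA// mulmx0.
by apply: eq_bigr => v _; rewrite prefixB// ltnW.
Qed.

(** The equation for [g] is solvable because payoffs are centred phase by phase. The one for [q] is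
    solvable because [var] makes its source average to zero, which requires computing the stationary
    covariance of each payoff with the next value of [g]. *)
Lemma two_block_correctors : exists (c : nat -> R) (g q : nat -> 'cV[R]_n),
  [/\ forall k, c (k %% L)%N = c k, \sum_(k < L) c k = L%:R * mu,
      forall k, g (k %% L)%N = g k, forall k, q (k %% L)%N = q k &
      forall k i,
        \sum_j block_mx_at k i j * (W i j - c k + g k.+1 j 0) = g k i 0 /\
        \sum_j block_mx_at k i j * ((W i j - c k) ^+ 2 / 2
          + (W i j - c k) * g k.+1 j 0 + q k.+1 j 0) = q k i 0 + var / 2].
Proof.
have ergM : ergodic (prefix_mx M L) by rewrite prefixL.
have piM : stationary (prefix_mx M L) pi0 by rewrite prefixL.
have b_per k : b (k %% L)%N = b k by rewrite /b c_per /Dm modn_mod.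
have [] := periodic_poisson L_gt0 M_per M_one ergM piM b_per.
  rewrite sum_b mulmx_sumr big1// => v _; rewrite !mulmxA; exact: row_b.
rewrite prefixL sum_b => g [g_per gE g0E].
(* [g] has stationary mean zero throughout the B block: [pi0 *m (Z - one *m pi0) = 0] at the end of
   the period, then backwards. *)
have g_row w : (w <= s)%N -> pi0 *m A ^+ r *m B ^+ (s - w) *m g (r + (s - w))%N = 0.
  elim: w => [|w IH] ws.
    rewrite subn0 -(mulmxA pi0) pi0_stationary.2 -g_per modnn g0E mulmxA.
    by rewrite pi0_Zsub ?mul0mx// -mulmxA B_exp_one A_exp_one.
  have ws' : (s - w.+1 < s)%N by rewrite ltn_subrL.
  rewrite gE M_B// mulmxDr row_b// addr0 mulmxA -(mulmxA _ (B ^+ _) B) B_expSr.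
  by rewrite -addnS subnSK// IH// ltnW.
(* The sum is the rest of the current period; [g 0] carries all later periods. *)
have g_tail w : (w <= s)%N -> g (r + w)%N =
    \sum_(v < s | (w <= v)%N) B ^+ (v - w) *m b (r + v) + B ^+ (s - w) *m g 0%N.
  move=> ws; rewrite -(subKn ws); move: (s - w)%N (leq_subr w s) => {ws w}.
  elim => [|w IH] ws.
    rewrite subn0 subnn mul1mx -g_per modnn big_pred0 ?add0r// => v.
    by rewrite leqNgt ltn_ord.
  have ws' : (s - w.+1 < s)%N by rewrite ltn_subrL.
  rewrite gE M_B// -addnS subnSK// IH ?(ltnW ws)// mulmxDr addrAC.
  rewrite mulmxA B_expS -subSn ?leq_subr// -(subnSK ws) subSS.
  congr (_ + _); rewrite [RHS](bigD1 (Ordinal ws'))//= subnn mul1mx addrC.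
  congr (_ + _); rewrite mulmx_sumr; apply: eq_big => [v|v vw].
    by rewrite -val_eqE/= andbC eq_sym ltn_neqAle.
  by rewrite mulmxA B_expS subnSK.
(* Covariances of each payoff with the future: [g_tail] splits them into the two double sums of the
   variance. *)
have var_key : \sum_(u < s) (pi0 *m A ^+ r *m B ^+ u *m D *m g (r + u.+1)%N) 0 0 =
    (L%:R * var - s%:R + \sum_(v < s) m v ^+ 2) / 2.
  rewrite varE mulVKf//.
  rewrite [RHS](_ : _ = \sum_(v < s) \sum_(u < v)
        (pi0 *m A ^+ r *m B ^+ u *m D
         *m (B ^+ (v - u - 1) - one *m pi0 *m A ^+ r *m B ^+ v)
         *m D *m one) 0 0
      + \sum_(u < s) \sum_(v < s)
        (pi0 *m A ^+ r *m B ^+ u *m D *m B ^+ (s - u - 1)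
         *m (Z - one *m pi0) *m A ^+ r *m B ^+ v
         *m D *m one) 0 0); last by field.
  (* Powers of [B] fix constants, so centring by [m v] becomes the subtracted rank-one term. *)
  have inner u v : (v < s)%N -> B ^+ (v - u.+1) *m b (r + v)%N =
      (B ^+ (v - u - 1) - one *m pi0 *m A ^+ r *m B ^+ v) *m D *m one.
    move=> vs; rewrite bB// mulmxBr -scalemxAr B_exp_one !mulmxBl -subnDA addn1.
    rewrite !mulmxA; congr (_ - _).
    have mE : pi0 *m (A ^+ r *m (B ^+ v *m (D *m one))) = (m v)%:M.
      by rewrite !mulmxA; exact: mx11_scalar.
    by rewrite -!mulmxA mE mul_mx_scalar.
  (* Here centring disappears, as [Z - one *m pi0] kills constants. *)
  have outer v : (v < s)%N -> (Z - one *m pi0) *m (A ^+ r *m B ^+ v *m b (r + v)%N) =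
      (Z - one *m pi0) *m A ^+ r *m B ^+ v *m D *m one.
    move=> vs; rewrite bB// !mulmxA mulmxBr -scalemxAr !mulmxA.
    rewrite -(mulmxA _ (B ^+ v) one) B_exp_one -(mulmxA _ (A ^+ r) one) A_exp_one.
    by rewrite Zsub_one ?scaler0 ?subr0// -mulmxA B_exp_one A_exp_one.
  transitivity (\sum_(u < s) (\sum_(v < s | (u < v)%N)
      (pi0 *m A ^+ r *m B ^+ u *m D
         *m (B ^+ (v - u - 1) - one *m pi0 *m A ^+ r *m B ^+ v)
         *m D *m one) 0 0 +
      \sum_(v < s)
        (pi0 *m A ^+ r *m B ^+ u *m D *m B ^+ (s - u - 1)
         *m (Z - one *m pi0) *m A ^+ r *m B ^+ v
         *m D *m one) 0 0)).
    apply: eq_bigr => u _; rewrite g_tail// mulmxDr mxE g0E; congr (_ + _).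
      rewrite mulmx_sumr summxE; apply: eq_bigr => v _.
      by rewrite inner// !mulmxA.
    rewrite !mulmx_sumr summxE; apply: eq_bigr => v _.
    by rewrite outer// -subnDA addn1 !mulmxA.
  rewrite big_split/=; congr (_ + _).
  rewrite (exchange_big_dep xpredT)//=; apply: eq_bigr => v _.
  pose F u := (pi0 *m A ^+ r *m B ^+ u *m D
         *m (B ^+ (v - u - 1) - one *m pi0 *m A ^+ r *m B ^+ v)
         *m D *m one) 0 0.
  by rewrite -[LHS]/(\sum_(u < s | (u < v)%N) F u) (big_ord_widen s F)// ltnW.
pose h k : 'cV[R]_n := \col_i (\sum_j M k i j * ((W i j - c k) ^+ 2 / 2
         + (W i j - c k) * g k.+1 j 0) - var / 2).
have h_per k : h (k %% L)%N = h k.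
  apply/colP => i; rewrite !mxE M_per c_per.
  have -> // : g (k %% L).+1%N = g k.+1.
  by rewrite -g_per -[in LHS]addn1 modnDml addn1 g_per.
have hA k : (k < r)%N -> h k = (- (var / 2)) *: one.
  move=> kr; apply/colP => i; rewrite !mxE cA// mulr1.
  rewrite big1 ?add0r// => j _; rewrite subr0.
  rewrite (_ : _ + _ = W i j * (W i j / 2 + g k.+1 j 0)); last by field.
  have Mk : M k = A by rewrite /M /block_mx_at modn_small ?ltn_addr// kr.
  by rewrite mulrA Mk AW mul0r.
(* Expanding the square, [W^2] is replaced by 1 under [B]. *)
have hB v : (v < s)%N -> h (r + v)%N = D *m g (r + v.+1)%N - m v *: (B *m g (r + v.+1)%N)
    - m v *: (D *m one) + ((1 + m v ^+ 2 - var) / 2) *: one.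
  move=> vs; apply/colP => i; rewrite !mxE cB// M_B// addnS.
  have B1 : \sum_j B i j = 1.
    have := congr1 (fun x : 'cV[R]_n => x i 0) B_one; rewrite !mxE => <-.
    by apply: eq_bigr => j _; rewrite mxE mulr1.
  transitivity (\sum_j (B i j * ((1 + m v ^+ 2) / 2) + D i j * g (r + v).+1 j 0 -
     m v * (B i j * g (r + v).+1 j 0) - m v * (D i j * 1)) - var / 2).
    congr (_ - _); apply: eq_bigr => j _; rewrite -BW.
    transitivity (B i j * W i j ^+ 2 / 2 + B i j * (- m v * W i j + m v ^+ 2 / 2 +
      (W i j - m v) * g (r + v).+1 j 0)); first by field.
    by rewrite BWW; field.
  rewrite !sumrB !big_split/= -!mulr_suml -!mulr_sumr B1.
  rewrite [X in _ = _ + X]mulr1 mulrBl mul1r.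
  have -> : \sum_j D i j * one j 0 = \sum_j D i j * 1.
    by apply: eq_bigr => j _; rewrite mxE.
  by field.
have := periodic_poisson L_gt0 M_per M_one ergM piM h_per.
case.
  rewrite big_split_ord/= mulmxDr.
  have -> : \sum_(k < r) prefix_mx M k *m h k = (- (r%:R * (var / 2))) *: one.
    rewrite (eq_bigr (fun=> (- (var / 2)) *: one)); last first.
      by move=> k _; rewrite hA// -scalemxAr prefixA ?A_exp_one// ltnW.
    by rewrite sumr_const card_ord -scaler_nat scalerA mulrN.
  rewrite mulmx_sumr.
  (* In stationary mean the [B] term vanishes by [g_row] and the [D] term is [m v], turning
     [+ m v^2] into [- m v^2]. With [var_key] and the [r] steps of the A block, the total is
     zero. *)
  rewrite (eq_bigr (fun v : 'I_s =>
     ((pi0 *m A ^+ r *m B ^+ v *m D *m g (r + v.+1)%N) 0 0 +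
      (1 - m v ^+ 2 - var) / 2)%:M)); last first.
    move=> v _; rewrite prefixB ?(ltnW (ltn_ord v))// hB// !mulmxA.
    rewrite mulmxDr !mulmxBr -!scalemxAr row_one !mulmxA.
    rewrite -(mulmxA _ (B ^+ v) B) B_expSr.
    have := g_row (s - v.+1)%N (leq_subr _ _); rewrite subKn// => ->.
    rewrite scaler0 subr0 [X in X - _ + _]mx11_scalar [X in _ - _ *: X + _]mx11_scalar.
    rewrite -/(m v) scale_scalar_mx scalemx1 -!raddfB -!raddfD/=; congr (_%:M).
    by field.
  rewrite -scalemxAr (stationary_mul_one piM) scalemx1.
  rewrite -(raddf_sum (@scalar_mx R 1)) -raddfD/=.
  rewrite big_split/= var_key -mulr_suml !sumrB !sumr_const card_ord.
  rewrite -[X in X%:M](_ : 0 = _) ?raddf0//.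
  rewrite -[1 *+ s]/(s%:R) -[var *+ s]mulr_natl natrD; by field.
move=> q [q_per qE _].
have M1 k i : \sum_j M k i j = 1.
  have := congr1 (fun x : 'cV[R]_n => x i 0) (M_one k); rewrite !mxE => <-.
  by apply: eq_bigr => j _; rewrite mxE mulr1.
have DmE k i j : Dm k i j = M k i j * W i j.
  by rewrite /Dm /M /block_mx_at; case: ifP => _; rewrite ?AW ?BW ?mxE.
exists c, g, q; split => // k i; split.
- transitivity (\sum_j (M k i j * g k.+1 j 0 + Dm k i j * one j 0 - M k i j * c k)).
    by apply: eq_bigr => j _; rewrite DmE mxE -/M; ring.
  rewrite sumrB big_split/= -mulr_suml M1 [in RHS]gE !mxE.
  by ring.
- transitivity (\sum_j (M k i j * ((W i j - c k) ^+ 2 / 2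
         + (W i j - c k) * g k.+1 j 0) + M k i j * q k.+1 j 0)).
    by apply: eq_bigr => j _; rewrite mulrDr.
  by rewrite big_split/= [in RHS]qE !mxE; ring.
Qed.

End TwoBlockCorrectors.

(** * From matrix identities to the chain of games *)

Lemma kernel_mx_sum (R : realType) (S : finType) (K : S -> S -> R) x (F : S -> R) :
  \sum_y K x y * F y = \sum_j kernel_mx K (enum_rank x) j * F (enum_val j).
Proof.
rewrite (reindex (@enum_val S xpredT)); last exact/onW_bij/enum_val_bij.
by apply: eq_bigr => j _; rewrite mxE enum_rankK.
Qed.

Lemma kernel_mx_one (R : realType) (S : finType) (K : S -> S -> R) :
  (forall x, \sum_y K x y = 1) -> kernel_mx K *m const_mx 1 = const_mx 1 :> 'cV_#|S|.
Proof.
move=> K1; apply/colP => i; rewrite mxE [RHS]mxE -(K1 (enum_val i)).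
under [RHS]eq_bigr => y _ do rewrite -[K _ _]mulr1.
rewrite (kernel_mx_sum K _ (fun=> 1)) enum_valK; apply: eq_bigr => j _.
by rewrite !mxE K1.
Qed.

Unset Implicit Arguments.

Theorem theorem9 (R : realType) (N r s : nat) (p : 'I_4 -> R)
  (hN : (3 <= N)%N) (hr : (1 <= r)%N) (hs : (1 <= s)%N)
  (hp : forall m, 0 <= p m <= 1)
  (herg : ergodic (period_mx N p r s))
  (hcyc : forall k, (k < r + s)%N -> ergodic (cyclic_mx N p r s k))
  (pi0 : 'rV[R]_#|state N|) (hpi0 : stationary (period_mx N p r s) pi0)
  (d : measure_display) (Omega : measurableType d) (P : probability Omega R)
  (X : nat -> Omega -> state N)
  (hX : markov_chain P (step_kernel p r s) X) :
  {ae P, forall w,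
     (fun n : nat => cumulative_profit R X n w / n%:R) @ \oo
       --> mean_profit p r s pi0} /\
  (0 < variance_profit p r s pi0 ->
   cvg_in_distribution P
     (fun (n : nat) (w : Omega) =>
        (cumulative_profit R X n w - n%:R * mean_profit p r s pi0)
        / Num.sqrt (n%:R * variance_profit p r s pi0))
     (normal_prob 0 1)).
Proof.
set mu := mean_profit p r s pi0; set v := variance_profit p r s pi0.
pose L := (r + s)%N.
have L_gt0 : (0 < L)%N by rewrite addn_gt0 hr.
pose W (i j : 'I_#|state N|) : R := payoff R (enum_val i) (enum_val j).
have A_one : mxA' R N *m const_mx 1 = const_mx 1 :> 'cV_#|state N|.
  by apply: kernel_mx_one => a; exact: kernelA'_sum1.
have B_one : mxB N p *m const_mx 1 = const_mx 1 :> 'cV_#|state N|.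
  by apply: kernel_mx_one => a; exact: kernelB_sum1.
have AW i j : mxA' R N i j * W i j = 0 by rewrite mxE kernelA'_payoff.
have BW i j : mxB N p i j * W i j = dotB N p i j by rewrite !mxE.
have BWW i j : mxB N p i j * W i j ^+ 2 = mxB N p i j by rewrite mxE kernelB_payoff_sqr.
have [c [g [q [c_per c_sum g_per q_per eqs]]]] :=
  two_block_correctors hs A_one B_one AW BW BWW herg hpi0 (erefl mu) (erefl v).
have step_mx k : kernel_mx (step_kernel p r s k) = block_mx_at r s (mxA' R N) (mxB N p) k.
  by rewrite /step_kernel /block_mx_at; case: ifP.
have Q_ge0 k (i j : state N) : 0 <= step_kernel p r s k i j :> R.
  by rewrite /step_kernel; case: ifP => _; [exact: kernelA'_ge0|exact: kernelB_ge0].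
have Q_sum1 k (i : state N) : \sum_(j : state N) step_kernel p r s k i j = 1 :> R.
  by rewrite /step_kernel; case: ifP => _; [exact: kernelA'_sum1|exact: kernelB_sum1].
have [Kc0 hKc0] := periodic_mean L_gt0 c_per c_sum.
have [Kg hKg] := periodic_bounded L_gt0 g_per.
have [Kq hKq] := periodic_bounded L_gt0 q_per.
have [Kc hKc] : exists K, forall k, `|c k| <= K.
  have := @periodic_bounded R L L_gt0 1 (fun k => const_mx (c k)).
  case=> [k|K hK]; first by rewrite c_per.
  by exists K => k; have := hK k 0; rewrite mxE.
(* One constant for all the bounds; the final 1 is the bound on a payoff. *)
pose K := `|Kc0| + `|Kg| + `|Kq| + `|Kc| + 1.
have nn := @normr_ge0.
have K1 z w : `|z| <= w -> `|w| <= K - 1 -> `|z| <= K.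
  by move=> h1 h2; apply: le_trans h1 _; have := ler_norm w; lra.
pose gf k (i : state N) := g k (enum_rank i) 0.
pose qf k (i : state N) := q k (enum_rank i) 0.
have pay_le k i j : `|payoff R (i : state N) j - c k| <= K.
  apply: le_trans (ler_normB _ _) _; rewrite /K addrC.
  apply: lerD; last exact: payoff_le1.
  apply: le_trans (hKc k) _; apply: le_trans (ler_norm _) _.
  by rewrite lerDr !addr_ge0.
have g_le k i : `|gf k i| <= K.
  apply: K1 (hKg _ _) _; rewrite /K.
  by have := nn _ _ Kc0; have := nn _ _ Kq; have := nn _ _ Kc; lra.
have q_le k i : `|qf k i| <= K.
  apply: K1 (hKq _ _) _; rewrite /K.
  by have := nn _ _ Kc0; have := nn _ _ Kg; have := nn _ _ Kc; lra.
have c_mean n : `|\sum_(k < n) c k - n%:R * mu| <= K.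
  apply: K1 (hKc0 _) _; rewrite /K.
  by have := nn _ _ Kq; have := nn _ _ Kg; have := nn _ _ Kc; lra.
have g_poisson k (i : state N) : \sum_(j : state N) step_kernel p r s k i j *
    (payoff R i j - c k + gf k.+1 j) = gf k i.
  rewrite (kernel_mx_sum (step_kernel p r s k)) step_mx -[RHS](eqs k _).1; apply: eq_bigr => j _.
  by rewrite /W /gf enum_rankK enum_valK.
have q_poisson k (i : state N) : \sum_(j : state N) step_kernel p r s k i j *
    ((payoff R i j - c k) ^+ 2 / 2 + (payoff R i j - c k) * gf k.+1 j + qf k.+1 j)
    = qf k i + v / 2.
  rewrite (kernel_mx_sum (step_kernel p r s k)) step_mx -[RHS](eqs k _).2; apply: eq_bigr => j _.
  by rewrite /W /gf /qf enum_rankK enum_valK.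
have t0 : 0 \in profits by [].
pose x0 : state N := ([ffun=> false], SeqSub t0).
split.
  have [M [M0 hM]] := variance_linear hX x0 Q_sum1 g_le q_le c_mean g_poisson q_poisson.
  have h := payoff_slln hX (@payoff_le1 R N) M0 hM; exact: h.
move=> v0 x _.
have [B [B0 hB]] := @DPhi_bounded R.
have K0 : 0 <= K by exact: le_trans (nn _ _ _) (g_le 0%N x0).
have sb (eps a : R) (n : nat) (e0 : 0 < eps) := smoothed_clt_bound hX x0 Q_ge0 Q_sum1 pay_le g_le q_le
  c_mean g_poisson q_poisson a e0 (ltW v0) hB n.
have v2 : 0 <= v / 2 by apply: divr_ge0 => //; exact: ltW.
have C3_ge0 : 0 <= K ^+ 3 + K * K ^+ 2 + K * K + K * (v / 2).
  by do ?[exact: v2|exact: K0|apply: addr_ge0|apply: exprn_ge0|apply: mulr_ge0].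
have C4_ge0 : 0 <= v ^+ 2 / 4 + K * (v / 2).
  by apply: addr_ge0; [apply: divr_ge0; rewrite ?sqr_ge0|exact: mulr_ge0].
have h := @payoff_clt _ _ _ _ _ _ _ hX x0 _ mu v B K _ _ v0 (ltW B0) K0 C3_ge0 C4_ge0 sb x.
have h2 : (fun n => P [set w | (cumulative_profit R X n w - n%:R * mu) /
    Num.sqrt (n%:R * v) <= x]) @ \oo --> (Phi x)%:E.
  have -> : (fun n => P [set w | (cumulative_profit R X n w - n%:R * mu) /
      Num.sqrt (n%:R * v) <= x]) = fun n => (expect P X x0 (@payoff R N) n
      (fun _ y => ((y - n%:R * mu) / Num.sqrt (n%:R * v) <= x)%R%:R))%:E.
    apply/funext => n.
    have h3 := (prob_payoff hX x0 (@payoff R N) n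
      (fun y => (y - n%:R * mu) / Num.sqrt (n%:R * v) <= x)).
    exact: h3.
  by apply: cvg_EFin; [exact: nearW|exact: h].
by move: h2; rewrite /Phi fineK ?fin_num_measure.
Qed.
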